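(* Let $q=2^e$ with $e\ge3$ odd, $\sigma=2^{\frac{e+1}{2}}$, and let $\varepsilon\in\mathbb{F}_{q^2}\setminus\mathbb{F}_q$ satisfy $\varepsilon^2+\varepsilon+\delta=0$ with $\delta\in\mathbb{F}_q\setminus\{1\}$, $\mathrm{Tr}_{q/2}(\delta)=1$. Then $\mathrm{Aut}(\mathcal{H}^3_\varepsilon)=E\langle\vartheta,\phi\rangle$, where $$\phi:(x_0,x_1,x_2,x_3)\mapsto(x_0^2,x_1^2,x_2^2,x_3^2)\begin{pmatrix} 1&1&1&0\\ 0&\delta^{\frac{\sigma}{2}}\varepsilon^q&0&\delta^{\frac{\sigma}{2}}\varepsilon^q\\ 0&0&\delta^{\frac{\sigma}{2}}\varepsilon^q&\delta^{\frac{\sigma}{2}}\varepsilon^q\\ 0&0&0&\delta^{\sigma+1} \end{pmatrix},$$ and this group has order $4eq^3$.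
   Context: Points of $\mathrm{PG}(3,q^2)$ have homogeneous coordinates $(X_0,X_1,X_2,X_3)$; $\Pi_\infty$ is the plane $X_0=0$; affine coordinates are $x_i=X_i/X_0$. In exponents, $\sigma$ denotes the integer $2^{(e+1)/2}$ (so $\sigma/2=2^{(e-1)/2}$). $\mathrm{Tr}_{q/2}$ is the absolute trace of $\mathbb{F}_q$. Matrices act on row vectors of homogeneous coordinates by right multiplication. Put $\Gamma_\varepsilon(x)=[x+(x^q+x)\varepsilon]^{\sigma+2}+(x^q+x)^\sigma+(x^{2q}+x^2)\varepsilon+x^{q+1}+x^2$. The BT quasi-Hermitian variety $\mathcal{H}^3_\varepsilon$ is the set consisting of the affine points $(x_1,x_2,x_3)\in\mathbb{F}_{q^2}^3$ with $x_3^q+x_3=\Gamma_\varepsilon(x_1)+\Gamma_\varepsilon(x_2)$, together with the points $(0,X_1,X_2,X_3)$ with $X_1^{q+1}+X_2^{q+1}=0$. $\mathrm{Aut}(\mathcal{H}^3_\varepsilon)$ is the full automorphism (collineation) group of $\mathcal{H}^3_\varepsilon$, i.e. its setwise stabilizer in $\mathrm{P\Gamma L}_4(q^2)$. $E=\langle\tau_{\gamma_1,\gamma_2,\gamma_3}:\gamma_i\in\mathbb{F}_q\rangle$, a subgroup of $\mathrm{Aut}(\mathcal{H}^3_\varepsilon)$ of order $q^3$, where $\tau_{\gamma_1,\gamma_2,\gamma_3}\in\mathrm{PGL}_4(q^2)$ is represented by $$\begin{pmatrix}1&\gamma_1\varepsilon&\gamma_2\varepsilon&\gamma_3+(\gamma_1+\gamma_2)^\sigma\varepsilon\\0&1&0&\gamma_1+\gamma_1\varepsilon\\0&0&1&\gamma_2+\gamma_2\varepsilon\\0&0&0&1\end{pmatrix}.$$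 $\vartheta\in\mathrm{PGL}_4(q^2)$ is the collineation $(x_0,x_1,x_2,x_3)\mapsto(x_0,x_2,x_1,x_3)$. *)

(* Defs.v *)
From HB Require Import structures.
From mathcomp Require Import all_boot all_order all_fingroup all_algebra.

Set Implicit Arguments.
Unset Strict Implicit.
Unset Printing Implicit Defensive.

Import GroupScope GRing.Theory.
Local Open Scope ring_scope.

Section ProjectiveSpace.
Variable F : finFieldType.

Definition line (v : 'rV[F]_4) : {set 'rV[F]_4} := [set a *: v | a : F].

(* A point of PG(3, F) is a one-dimensional subspace of F^4, represented by
   its set of vectors; homogeneous coordinates of P are the nonzero v \in P. *)
Definition is_point (P : {set 'rV[F]_4}) : bool :=
  [exists v : 'rV[F]_4, (v != 0) && (P == line v)].

Record point := Point { pset :> {set 'rV[F]_4}; _ : is_point pset }.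

HB.instance Definition _ := [isSub for pset].
HB.instance Definition _ := [Finite of point by <:].

Definition induces (s : {perm point}) (f : 'rV[F]_4 -> 'rV[F]_4) : bool :=
  [forall P : point, pset (s P) == f @: pset P].

(* The permutation of the points induced by f, with the junk value 1 if there
   is none; collineationP covers the bijective semilinear maps. *)
Definition collineation (f : 'rV[F]_4 -> 'rV[F]_4) : {perm point} :=
  odflt 1%g [pick s : {perm point} | induces s f].

Definition field_aut (theta : {perm F}) : bool :=
  [forall x, forall y, (theta (x + y) == theta x + theta y)
                       && (theta (x * y) == theta x * theta y)].

Definition semilin (theta : F -> F) (A : 'M[F]_4) (v : 'rV[F]_4) : 'rV[F]_4 :=
  map_mx theta v *m A.

(* PGammaL_4(F), as the group of permutations of the points of PG(3, F)
   induced by bijective semilinear maps. *)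
Definition PGammaL : {set {perm point}} :=
  [set s : {perm point} | [exists theta : {perm F}, field_aut theta &&
     [exists A : 'M[F]_4, (A \in unitmx) && induces s (semilin theta A)]]].

Definition row4 (a b c d : F) : 'rV[F]_4 := \row_j nth 0 [:: a; b; c; d] j.

Definition mx4 (s : seq (seq F)) : 'M[F]_4 :=
  \matrix_(i, j) nth 0 (nth [::] s i) j.

Lemma mem_line v : v \in line v.
Proof. by apply/imsetP; exists 1; rewrite ?scale1r. Qed.

Lemma induces_inj s t f : induces s f -> induces t f -> s = t.
Proof.
move=> /forallP Hs /forallP Ht; apply/permP=> P; apply: val_inj => /=.
by rewrite (eqP (Hs P)) (eqP (Ht P)).
Qed.

Lemma collineationP (theta : F -> F) f :
  injective theta -> injective f -> f 0 = 0 ->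
  (forall a v, f (a *: v) = theta a *: f v) ->
  induces (collineation f) f.
Proof.
move=> it jf f0 fZ.
have fl v : f @: line v = line (f v).
  apply/setP=> w; apply/imsetP/imsetP=> [[u /imsetP[a _ ->] ->]|[a _ ->]].
    by exists (theta a); rewrite ?fZ.
  exists (invF it a *: v); last by rewrite fZ f_invF.
  by apply/imsetP; exists (invF it a).
have fP (P : point) : is_point (f @: pset P).
  case: P => P /= /existsP[v /andP[v0 /eqP->]]; rewrite fl.
  apply/existsP; exists (f v); rewrite eqxx andbT.
  by apply: contraNneq v0 => fv0; apply/eqP/jf; rewrite fv0 f0.
have pinj : injective (fun P : point => Point (fP P)).
  by move=> P Q [] /(imset_inj jf)/val_inj.
rewrite /collineation; case: pickP => [s //|/(_ (perm pinj))/negP[]].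
by apply/forallP=> P; rewrite permE.
Qed.

Lemma field_autP (theta : {perm F}) : field_aut theta ->
  (forall x y, theta (x + y) = theta x + theta y) *
  (forall x y, theta (x * y) = theta x * theta y).
Proof.
move=> /forallP H; split=> x y;
  by have /forallP/(_ y)/andP[/eqP ? /eqP ?] := H x.
Qed.

Lemma semilin_comp (t1 t2 : {perm F}) A1 A2 v : field_aut t2 ->
  semilin t2 A2 (semilin t1 A1 v) = semilin (t1 * t2)%g (map_mx t2 A1 *m A2) v.
Proof.
move=> /field_autP[tD tM]; rewrite /semilin mulmxA; congr (_ *m _).
have t0 : t2 0 = 0 by apply: (addrI (t2 0)); rewrite -tD !addr0.
apply/rowP=> j; rewrite !mxE (big_morph t2 tD t0); apply: eq_bigr => i _.
by rewrite !mxE tM permM.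
Qed.

Lemma map_unitmx_aut (t : {perm F}) (A : 'M[F]_4) :
  field_aut t -> A \in unitmx -> map_mx t A \in unitmx.
Proof.
move=> /field_autP[tD tM] uA.
have t0 : t 0 = 0 by apply: (addrI (t 0)); rewrite -tD !addr0.
have t1 : t 1 = 1.
  have n0 : t 1 != 0 by rewrite -t0 (inj_eq perm_inj) oner_eq0.
  by apply: (mulIf n0); rewrite -tM !mul1r.
suff [] : map_mx t A \in unitmx /\ map_mx t (invmx A) \in unitmx by [].
apply: mulmx1_unit; apply/matrixP=> i j.
have /matrixP/(_ i j) := mulmxV uA; rewrite !mxE => /(congr1 t).
rewrite (big_morph t tD t0) => E; transitivity (t (i == j)%:R).
  by rewrite -E; apply: eq_bigr => k _; rewrite !mxE tM.
by case: (i == j).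
Qed.

Lemma PGammaL_group_set : group_set PGammaL.
Proof.
apply/group_setP; split=> [|s t].
  rewrite inE; apply/existsP; exists 1%g; apply/andP; split.
    by apply/forallP=> x; apply/forallP=> y; rewrite !perm1 !eqxx.
  apply/existsP; exists 1%:M; rewrite unitmx1 /=; apply/forallP=> P.
  rewrite perm1 eq_sym; apply/eqP.
  rewrite -[RHS]imset_id; apply: eq_imset => v.
  by rewrite /semilin mulmx1; apply/rowP=> j; rewrite mxE perm1.
rewrite !inE => /existsP[t1 /andP[H1 /existsP[A1 /andP[u1 /forallP I1]]]].
move=> /existsP[t2 /andP[H2 /existsP[A2 /andP[u2 /forallP I2]]]].
apply/existsP; exists (t1 * t2)%g; apply/andP; split.
  have [d1 m1] := field_autP H1; have [d2 m2] := field_autP H2.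
  by apply/forallP=> x; apply/forallP=> y; rewrite !permM d1 d2 m1 m2 !eqxx.
apply/existsP; exists (map_mx t2 A1 *m A2).
rewrite unitmx_mul u2 map_unitmx_aut //=; apply/forallP=> P.
rewrite permM (eqP (I2 _)) (eqP (I1 _)) -imset_comp; apply/eqP.
by apply: eq_imset => v /=; rewrite semilin_comp.
Qed.

Canonical PGammaL_group := Group PGammaL_group_set.

End ProjectiveSpace.

Definition sigma (e : nat) : nat := 2 ^ (e.+1)./2.

Section BTQuasiHermitian.
(* F stands for the field with q ^ 2 elements, q = 2 ^ e. *)
Variables (F : finFieldType) (e : nat).
Let q : nat := (2 ^ e)%N.

Definition Fq : {set F} := [set x | x ^+ q == x].

Definition abs_trace (x : F) : F := \sum_(i < e) x ^+ (2 ^ i).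

Variable eps : F.

Definition Gamma (x : F) : F :=
  (x + (x ^+ q + x) * eps) ^+ (sigma e + 2) + (x ^+ q + x) ^+ sigma e
  + (x ^+ (2 * q) + x ^+ 2) * eps + x ^+ q.+1 + x ^+ 2.

Definition BT_variety : {set point F} :=
  [set P : point F |
     [exists x1, exists x2, exists x3,
        (row4 1 x1 x2 x3 \in pset P)
        && (x3 ^+ q + x3 == Gamma x1 + Gamma x2)]
  || [exists X1, exists X2, exists X3,
        [&& row4 0 X1 X2 X3 != 0, row4 0 X1 X2 X3 \in pset P
          & X1 ^+ q.+1 + X2 ^+ q.+1 == 0]]].

Definition AutBT : {set {perm point F}} := 'N_(PGammaL F)(BT_variety | 'P)%g.

Canonical AutBT_group := [group of AutBT].

Definition tau_mx (g1 g2 g3 : F) : 'M[F]_4 :=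
  mx4 [:: [:: 1; g1 * eps; g2 * eps; g3 + (g1 + g2) ^+ sigma e * eps];
          [:: 0; 1;        0;        g1 + g1 * eps];
          [:: 0; 0;        1;        g2 + g2 * eps];
          [:: 0; 0;        0;        1]].

Definition tau (g1 g2 g3 : F) : {perm point F} :=
  collineation (fun v => v *m tau_mx g1 g2 g3).

Definition Egroup : {set {perm point F}} :=
  <<[set s | [exists g1 in Fq, exists g2 in Fq, exists g3 in Fq,
                s == tau g1 g2 g3]]>>%g.

Definition swap12 (v : 'rV[F]_4) : 'rV[F]_4 :=
  row4 (v 0 0) (v 0 2) (v 0 1) (v 0 3).

Definition vartheta : {perm point F} := collineation swap12.

Variable delta : F.

Definition phi_mx : 'M[F]_4 :=
  let k := delta ^+ (sigma e)./2 * eps ^+ q in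
  mx4 [:: [:: 1; 1; 1; 0];
          [:: 0; k; 0; k];
          [:: 0; 0; k; k];
          [:: 0; 0; 0; delta ^+ (sigma e).+1]].

Definition phi : {perm point F} :=
  collineation (semilin (fun x => x ^+ 2) phi_mx).

(* In the situation of interest the three permutations above are the intended
   ones, not the junk value of collineation. *)

Lemma linear_collineationP (A : 'M[F]_4) : A \in unitmx ->
  induces (collineation (fun v => v *m A)) (fun v => v *m A).
Proof.
move=> uA; apply: (@collineationP F id) => //; first exact: can_inj (mulmxK uA).
  exact: mul0mx.
by move=> a v; rewrite scalemxAl.
Qed.

Lemma mx4_upper_unit (s : seq (seq F)) :
  (forall i j : 'I_4, (j < i)%N -> nth 0 (nth [::] s i) j = 0) ->
  (forall i : 'I_4, nth 0 (nth [::] s i) i != 0) -> mx4 s \in unitmx.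
Proof.
move=> up dg; rewrite unitmxE -det_tr det_trig.
  by rewrite unitfE; apply/prodf_neq0 => i _; rewrite !mxE.
by apply/is_trig_mxP => i j ij; rewrite !mxE up.
Qed.

Lemma tauP g1 g2 g3 : induces (tau g1 g2 g3) (fun v => v *m tau_mx g1 g2 g3).
Proof.
apply: linear_collineationP; apply: mx4_upper_unit.
  by move=> [[|[|[|[|i]]]] ?] [[|[|[|[|j]]]] ?].
by move=> [[|[|[|[|i]]]] ?] //=; rewrite oner_eq0.
Qed.

Lemma varthetaP : induces vartheta swap12.
Proof.
have E (v : 'rV[F]_4) j : swap12 v 0 j = v 0 (tperm 1 2 j).
  rewrite mxE permE /=; case: j => [[|[|[|[|j]]]] lj] //=;
  by congr (v 0 _); apply: val_inj.
apply: (@collineationP F id) => //.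
- move=> u v uv; apply/rowP=> j.
  by have := E u (tperm 1 2 j); rewrite uv E !tpermK.
- by apply/rowP=> j; rewrite E !mxE.
by move=> a v; apply/rowP=> j; rewrite E !mxE -E !mxE.
Qed.

Lemma phiP : 2 \in [pchar F] -> eps != 0 -> delta != 0 ->
  induces phi (semilin (fun x => x ^+ 2) phi_mx).
Proof.
move=> c2 e0 d0.
have uM : phi_mx \in unitmx.
  apply: mx4_upper_unit.
    by move=> [[|[|[|[|i]]]] ?] [[|[|[|[|j]]]] ?].
  by move=> [[|[|[|[|i]]]] ?] //=; rewrite ?oner_eq0 ?mulf_neq0 ?expf_neq0.
have i2 : injective (fun x : F => x ^+ 2).
  by move=> x y /=; rewrite -!(pFrobenius_autE c2) => /fmorph_inj.
apply: (@collineationP F (fun x => x ^+ 2)) => //.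
- move=> u v /(can_inj (mulmxK uM)) /rowP uv; apply/rowP=> j.
  by have := uv j; rewrite !mxE => /i2.
- rewrite /semilin; have -> : map_mx (fun x : F => x ^+ 2) (0 : 'rV_4) = 0.
    by apply/rowP=> j; rewrite !mxE expr0n.
  exact: mul0mx.
move=> a v; rewrite /semilin scalemxAl; congr (_ *m _).
by apply/rowP=> j; rewrite !mxE exprMn.
Qed.

End BTQuasiHermitian.

(* Main.v *)
Require Import Defs.
From mathcomp Require Import all_boot all_order all_fingroup all_algebra.
From mathcomp Require Import cyclic finfield zify.
From Stdlib Require Import Ring.
Import GroupScope GRing.Theory.
Local Open Scope ring_scope.
Set Implicit Arguments.
Unset Strict Implicit.
Unset Printing Implicit Defensive.

(** Write x = a + b eps with a = re x and b = im x in F_q.  Since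
    eps ^ q = eps + 1, the map Gamma takes its values in F_q and becomes
    Gamma x = a ^ (sigma + 2) + a b + b ^ sigma, the form of the Suzuki-Tits
    ovoid; the affine part of the variety is im x3 = Gamma x1 + Gamma x2.
    Restrict such an equation to points x + t d with t running over F_q: as
    squares and powers x ^ sigma are additive, each side is a polynomial in t
    with exponents among sigma + 2, sigma, 2, 1, 0, all distinct and all smaller
    than q, so the two sides agree coefficient by coefficient ([Fq_coefs0],
    [Gamma_shift]).  All the rigidity comes from this comparison.

    The first use is to recognise the point P = (0,0,0,1) from the variety
    alone: it is the only point p for which every vector v on the cone of the
    variety admits a nonzero m with v + t m p on the cone for all t in F_q
    ([baer_vertex_e3], [baer_vertex_uniq]).  The variety contains lines outside
    the plane X0 = 0 and it has other points whose lines in the variety form a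
    planar pencil of q + 1 lines, so the lines that it contains do not single P
    out; the condition above does, because the lines on P that are not contained
    in the variety meet it in Baer sublines or in P alone.  The plane X0 = 0 is
    then recovered from the lines on P that lie in the variety.

    Hence a projectivity preserving the variety is affine and fixes P.  The
    coefficient of t ^ sigma, polarised, is the form
    u ^ sigma u' ^ 2 + w ^ sigma w' ^ 2 in u = re x1 and w = re x2, which its
    linear part must preserve up to a scalar; this forces the linear part to be
    diagonal or antidiagonal in (x1, x2), and the remaining coefficients leave
    exactly the maps tau and tau vartheta ([rigid_monomial], [rigid_diag], [linear_cases]).

    Finally, every automorphism of F is a power of the Frobenius map, and phi
    is an automorphism of the variety inducing that map.  So for each
    automorphism g of the variety some g phi ^ j with j < 2 e is linear, and
    g = tau vartheta ^ b phi ^ -j.  This writing is unique, because a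
    permutation induced by an invertible matrix is not induced by a semilinear
    map with a nontrivial field automorphism ([linear_semilin_id]).  Counting
    the parameters gives q ^ 3 * 2 * 2 e ([decode_onto], [decode_inj]). *)

(** * Semilinear maps and the permutations of points that they induce *)

Section SemilinearMaps.
Variable F : finFieldType.
Notation row4 := (@row4 F).

Lemma row4E a b c d :
  (row4 a b c d 0 0 = a) * (row4 a b c d 0 1 = b)
  * (row4 a b c d 0 2 = c) * (row4 a b c d 0 3 = d).
Proof. by rewrite !mxE. Qed.

Lemma row4_ext (u v : 'rV[F]_4) : u 0 0 = v 0 0 -> u 0 1 = v 0 1 ->
  u 0 2 = v 0 2 -> u 0 3 = v 0 3 -> u = v.
Proof.
move=> h0 h1 h2 h3; apply/rowP => -[[|[|[|[|i]]]] hi] //;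
  [move: h0|move: h1|move: h2|move: h3];
  by congr (_ = _); congr (_ _ _); apply: val_inj.
Qed.

Lemma row4_eta (v : 'rV[F]_4) : v = row4 (v 0 0) (v 0 1) (v 0 2) (v 0 3).
Proof. by apply: row4_ext; rewrite row4E. Qed.

Lemma row4D a b c d a' b' c' d' :
  row4 a b c d + row4 a' b' c' d' = row4 (a + a') (b + b') (c + c') (d + d').
Proof. by apply: row4_ext; rewrite !mxE. Qed.

Lemma row4Z k a b c d : k *: row4 a b c d = row4 (k * a) (k * b) (k * c) (k * d).
Proof. by apply: row4_ext; rewrite !mxE. Qed.

Lemma row4_00 : row4 0 0 0 0 = 0.
Proof. by apply: row4_ext; rewrite !mxE. Qed.

Lemma row4_1_neq0 a b c : row4 1 a b c != 0.
Proof. by apply/eqP => /rowP/(_ 0)/eqP; rewrite row4E mxE oner_eq0. Qed.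

Lemma row4_01_neq0 b c : row4 0 1 b c != 0.
Proof. by apply/eqP => /rowP/(_ 1)/eqP; rewrite row4E mxE oner_eq0. Qed.

Lemma mulmx4 (v : 'rV[F]_4) (A : 'M[F]_4) j :
  (v *m A) 0 j = v 0 0 * A 0 j + v 0 1 * A 1 j + v 0 2 * A 2 j + v 0 3 * A 3 j.
Proof.
rewrite mxE !big_ord_recl big_ord0 addr0 !addrA.
by congr (_ + _ + _ + _); congr (v _ _ * A _ _); apply: val_inj.
Qed.

Lemma pset_line (P : point F) v : v \in pset P -> v != 0 -> pset P = line v.
Proof.
case: P => P /= /existsP[w /andP[w0 /eqP->]] /imsetP[a _ ->].
rewrite scaler_eq0 negb_or => /andP[a0 _]; apply/setP => u.
apply/imsetP/imsetP => -[b _ ->]; last by exists (b * a); rewrite ?scalerA.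
by exists (b / a); rewrite // scalerA divfK.
Qed.

Lemma point_of_key v : v != 0 -> is_point (line v : {set 'rV[F]_4}).
Proof. by move=> v0; apply/existsP; exists v; rewrite v0 eqxx. Qed.

Definition point_of v (v0 : v != 0) : point F := Point (point_of_key v0).

Lemma induces_mem (g : {perm point F}) f (P : point F) v :
  induces g f -> v \in pset P -> f v \in pset (g P).
Proof. by move=> /forallP/(_ P)/eqP -> vP; apply: imset_f. Qed.

Lemma induces_eq (g : {perm point F}) f f' : f =1 f' -> induces g f -> induces g f'.
Proof.
by move=> ff /forallP h; apply/forallP => P; rewrite (eqP (h P)); apply/eqP/eq_imset.
Qed.

Lemma induces_comp (g g' : {perm point F}) f f' : induces g f -> induces g' f' ->
  induces (g * g')%g (f' \o f).
Proof.
move=> /forallP h /forallP h'; apply/forallP => P.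
by rewrite permM (eqP (h' _)) (eqP (h _)) -imset_comp.
Qed.

(** Scaling a homogeneous map does not change the map that it induces on
    points; this is what allows matrices to be normalised. *)
Lemma induces_scale (g : {perm point F}) f c : c != 0 ->
  (forall a v, f (a *: v) = a *: f v) ->
  induces g (fun v => c *: f v) -> induces g f.
Proof.
move=> c0 fZ /forallP h; apply/forallP => P; rewrite (eqP (h P)); apply/eqP.
case: P => P /= /existsP[w /andP[_ /eqP->]]; apply/setP => u.
apply/imsetP/imsetP => -[_ /imsetP[a _ ->] ->].
  by exists (c *: (a *: w)); rewrite ?fZ // scalerA; apply/imsetP; exists (c * a).
exists (c^-1 *: (a *: w)).
  by rewrite scalerA; apply/imsetP; exists (c^-1 * a).
by rewrite !fZ scalerA divff // scale1r.
Qed.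

Lemma induces_prop (g : {perm point F}) f f' v : v != 0 ->
  induces g f -> induces g f' -> (forall a, f' (a *: v) = a *: f' v) ->
  exists a, f v = a *: f' v.
Proof.
move=> v0 h h' fZ; have := induces_mem h (mem_line v : v \in pset (point_of v0)).
move/forallP/(_ (point_of v0))/eqP: h' => -> /imsetP[_ /imsetP[a _ ->] ->].
by exists a; rewrite fZ.
Qed.

Lemma semilin_eq (t t' : F -> F) (A : 'M[F]_4) : t =1 t' -> semilin t A =1 semilin t' A.
Proof.
by move=> h v; congr (_ *m _); apply/rowP => j; rewrite !mxE h.
Qed.

Lemma semilin_id (t : F -> F) (A : 'M[F]_4) : t =1 id ->
  semilin t A =1 (fun v => v *m A).
Proof. by move=> h v; congr (_ *m _); apply/rowP => j; rewrite !mxE h. Qed.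

Lemma semilin_neq0 (t : {perm F}) (A : 'M[F]_4) v : field_aut t -> A \in unitmx ->
  v != 0 -> semilin t A v != 0.
Proof.
move=> /field_autP[tD _] uA v0.
have t0 : t 0 = 0 by apply: (addrI (t 0)); rewrite -tD !addr0.
apply: contra v0 => /eqP h; have : map_mx t v = 0 by rewrite -[LHS](mulmxK uA) -/(semilin t A v) h mul0mx.
move/rowP => z; apply/eqP/rowP => j; have := z j; rewrite !mxE => hj.
by apply: (@perm_inj _ t); rewrite t0.
Qed.

Lemma semilin_row4 (t : F -> F) (A : 'M[F]_4) a b c d :
  semilin t A (row4 a b c d) = row4 (t a) (t b) (t c) (t d) *m A.
Proof. by congr (_ *m _); apply: row4_ext; rewrite !mxE. Qed.

Lemma semilinZ (t : {perm F}) (A : 'M[F]_4) c v : field_aut t ->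
  semilin t A (c *: v) = t c *: semilin t A v.
Proof.
move=> /field_autP[_ tM]; rewrite /semilin scalemxAl; congr (_ *m _).
by apply/rowP => j; rewrite !mxE tM.
Qed.

(** A matrix and a t-semilinear map that agree on points differ by a scalar on
    each vector.  Comparing the scalars at e0, e1 and e0 + x e1 shows that they
    coincide and then that t x = x. *)
Lemma linear_semilin_id (g : {perm point F}) (A M : 'M[F]_4) (t : {perm F}) :
  A \in unitmx -> M \in unitmx -> field_aut t ->
  induces g (fun v => v *m A) -> induces g (semilin t M) -> t =1 id.
Proof.
move=> uA uM ta hA hM; have [tD tM] := field_autP ta.
have t0 : t 0 = 0 by apply: (addrI (t 0)); rewrite -tD !addr0.
have t1 : t 1 = 1.
  have n0 : t 1 != 0 by rewrite -t0 (inj_eq perm_inj) oner_eq0.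
  by apply: (mulfI n0); rewrite -tM !mulr1.
pose B := M *m invmx A.
have key (v : 'rV[F]_4) : v != 0 -> exists a, map_mx t v *m B = a *: v.
  move=> v0; have [|a h] := induces_prop v0 hM hA.
    by move=> a; rewrite scalemxAl.
  by exists a; rewrite mulmxA -/(semilin t M v) h -scalemxAl mulmxK.
have tr a b c d : map_mx t (row4 a b c d) = row4 (t a) (t b) (t c) (t d).
  by apply: row4_ext; rewrite !mxE.
have [a ha] := key _ (row4_1_neq0 0 0 0); have [b hb] := key _ (row4_01_neq0 0 0).
rewrite tr t0 t1 in ha; rewrite tr t0 t1 in hb.
have xE x : a * x = t x * b.
  have [c] := key _ (row4_1_neq0 x 0 0); rewrite tr t0 t1.
  have -> : row4 1 (t x) 0 0 = row4 1 0 0 0 + t x *: row4 0 1 0 0.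
    by rewrite row4Z row4D !mulr0 mulr1 !addr0 add0r.
  rewrite mulmxDl -scalemxAl ha hb !row4Z row4D !mulr0 !mulr1 !addr0 add0r => h.
  move/rowP: h => h; have := h 0; have := h 1.
  by rewrite !row4E => -> ->.
have ab : a = b by have := xE 1; rewrite t1 mulr1 mul1r.
have a0 : a != 0.
  apply: contra (row4_1_neq0 0 0 0) => /eqP z.
  have uB : B \in unitmx by rewrite unitmx_mul uM unitmx_inv.
  by rewrite -[row4 _ _ _ _](mulmxK uB) ha z scale0r mul0mx.
by move=> x; apply: (mulfI a0); rewrite /= [RHS]xE -ab mulrC.
Qed.

Lemma swap12_mx (v : 'rV[F]_4) : swap12 v = v *m perm_mx (tperm 1 2).
Proof.
rewrite -tpermV -col_permE; apply: row4_ext; rewrite !mxE permE /=;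
  by congr (v 0 _); apply: val_inj.
Qed.

Lemma vartheta_lin : induces (vartheta F) (fun v => v *m perm_mx (tperm 1 2)).
Proof. by apply: induces_eq (varthetaP F) => v; rewrite swap12_mx. Qed.

End SemilinearMaps.

(** * Automorphisms of a finite field of characteristic two *)

Section FrobeniusPowers.
Variables (F : finFieldType) (N : nat).
Hypothesis pchar2 : 2 \in [pchar F].
Hypothesis cardF2 : #|F| = (2 ^ N)%N.

Lemma eq_of_add0_pchar2 (x y : F) : x + y = 0 -> x = y.
Proof. by move=> h; rewrite -[x]addr0 -(addrr_pchar2 pchar2 y) addrA h add0r. Qed.

Lemma exprD_pow2 k (x y : F) : (x + y) ^+ (2 ^ k) = x ^+ (2 ^ k) + y ^+ (2 ^ k).
Proof. by apply: exprDn_pchar; rewrite pnatX ?pnatE ?pchar2. Qed.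

Lemma expr_eq0W n (z : F) : z ^+ n = 0 -> z = 0.
Proof. by move=> h; apply/eqP/negPn/negP => /(expf_neq0 n); rewrite h eqxx. Qed.

Lemma N_gt0 : (0 < N)%N.
Proof. by rewrite lt0n; apply: contraTneq (finNzRing_gt1 F) => z; rewrite cardF2 z. Qed.

Lemma frob_inj j : injective (fun x : F => x ^+ (2 ^ j)).
Proof.
move=> x y h; apply: eq_of_add0_pchar2; apply: (@expr_eq0W (2 ^ j)).
by rewrite exprD_pow2 h (addrr_pchar2 pchar2).
Qed.

Definition frob j : {perm F} := perm (@frob_inj j).

Lemma frobE j x : frob j x = x ^+ (2 ^ j). Proof. by rewrite permE. Qed.

Lemma frob_aut j : field_aut (frob j).
Proof.
by apply/forallP=> x; apply/forallP=> y; rewrite !frobE exprD_pow2 exprMn !eqxx.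
Qed.

Lemma frob0 : frob 0 =1 id. Proof. by move=> x; rewrite frobE expn0 expr1. Qed.

Lemma finField_generator : exists z : F, forall x, x != 0 -> exists i : nat, x = z ^+ i.
Proof.
have F1 : (0 < #|F|.-1)%N by rewrite -card_finField_unit cardG_gt0.
have xu (x : F) : x != 0 -> x ^+ #|F|.-1 = 1.
  move=> x0; apply: (mulfI x0); rewrite -exprS prednK ?expf_card ?mulr1 //.
  exact: ltnW (finNzRing_gt1 F).
pose rs := enum [set x : F | x != 0].
have /hasP[z _ hz] : has #|F|.-1.-primitive_root rs.
  apply: has_prim_root => //; last 2 first.
  - exact: enum_uniq.
  - by rewrite -cardE -(cardC1 (0 : F)) subset_leq_card //; apply/subsetP => x; rewrite !inE.
  by apply/allP=> x; rewrite mem_enum inE => /xu h; apply/unity_rootP.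
by exists z => x /xu/(prim_rootP hz)[i ->]; exists i.
Qed.

(** Let z generate the multiplicative group.  The product P of the factors
    X - z ^ (2 ^ i), over one full period of the Frobenius map, is invariant
    under that map, so its coefficients are 0 or 1 and theta fixes them.  As
    P z = 0, also P (theta z) = 0, and theta z is one of the z ^ (2 ^ i). *)
Lemma field_aut_frob (theta : {perm F}) : field_aut theta ->
  exists2 i, (i < N)%N & forall x, theta x = x ^+ (2 ^ i).
Proof.
move=> /field_autP[tD tM]; have [z hz] := finField_generator.
have t0 : theta 0 = 0 by apply: (addrI (theta 0)); rewrite -tD !addr0.
have t1 : theta 1 = 1.
  have n0 : theta 1 != 0 by rewrite -t0 (inj_eq perm_inj) oner_eq0.
  by apply: (mulfI n0); rewrite -tM !mulr1.
have tX x n : theta (x ^+ n) = theta x ^+ n.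
  by elim: n => [|n IH]; rewrite ?expr0 // !exprS tM IH.
pose P := \prod_(i < N) ('X - (z ^+ (2 ^ i))%:P).
have Pfr : map_poly (pFrobenius_aut pchar2) P = P.
  rewrite map_prod_XsubC /P -(prednK N_gt0) big_ord_recr big_ord_recl mulrC /=.
  congr (_ * _).
    by apply: eq_bigr => i _; rewrite pFrobenius_autE -exprM -expnSr.
  rewrite pFrobenius_autE -exprM -expnSr prednK ?N_gt0 // -cardF2 expf_card.
  by rewrite expn0 expr1.
have Pc j : theta P`_j = P`_j.
  have /eqP : P`_j * (P`_j + 1) = 0.
    have := congr1 (fun p : {poly F} => p`_j) Pfr.
    by rewrite coef_map /= pFrobenius_autE mulrDr mulr1 -expr2 => ->; rewrite (addrr_pchar2 pchar2).
  by rewrite mulf_eq0 => /orP[/eqP->//|/eqP/eq_of_add0_pchar2 ->].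
have Pz : P.[z] = 0.
  rewrite horner_prod (bigD1 (Ordinal N_gt0)) //= hornerXsubC.
  by rewrite expn0 expr1 subrr mul0r.
have /eqP : P.[theta z] = 0.
  rewrite -t0 -Pz !horner_coef (big_morph theta tD t0).
  by apply: eq_bigr => j _; rewrite tM tX Pc.
rewrite horner_prod prodf_seq_eq0 => /hasP[i _ /=].
rewrite hornerXsubC subr_eq0 => /eqP tz.
exists i => // x; have [->|/hz[n ->]] := eqVneq x 0.
  by rewrite t0 expr0n expn_eq0.
by rewrite tX tz exprAC.
Qed.

(** Otherwise the polynomial X ^ (2 ^ d) - X would have 2 ^ N roots. *)
Lemma frob_fixes d : (d < N)%N -> (forall x : F, x ^+ (2 ^ d) = x) -> d = 0.
Proof.
move=> dN h; apply/eqP; rewrite -leqn0 leqNgt; apply/negP => d0.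
pose p : {poly F} := 'X^(2 ^ d) - 'X.
have d2 : (2 <= 2 ^ d)%N by rewrite (@leq_pexp2l 2 1).
have sp : size p = (2 ^ d).+1.
  by rewrite size_polyDl ?size_polyXn // size_polyN size_polyX.
have p0 : p != 0 by rewrite -size_poly_eq0 sp.
have rt : all (root p) (enum F).
  by apply/allP=> x _; rewrite /root /p !(hornerD, hornerN, hornerXn, hornerX) h subrr.
have := max_poly_roots p0 rt (enum_uniq F).
rewrite -cardE sp cardF2 ltnS leqNgt ltn_exp2l //.
by rewrite dN.
Qed.

End FrobeniusPowers.

(** * Ring normalisation modulo two *)

(** The operations of F under fresh names, on a carrier with a fresh name: the
    same operation of F occurs in terms through several equal but different
    instances, and folding them all to these constants lets normalisation
    see one ring, with coefficients in the booleans. *)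
Section CharTwoRing.
Variable F : finFieldType.
Hypothesis pchar2 : 2 \in [pchar F].

Definition carr : Type := F.
Definition add2 (x y : carr) : carr := (x : F) + (y : F).
Definition mul2 (x y : carr) : carr := (x : F) * (y : F).
Definition opp2 (x : carr) : carr := - (x : F).
Definition exp2 (x : carr) n : carr := (x : F) ^+ n.
Definition zero2 : carr := (0 : F).
Definition one2 : carr := (1 : F).
Definition of_bool (b : bool) : carr := if b then one2 else zero2.

Lemma char2_ring_theory :
  Ring_theory.ring_theory zero2 one2 add2 mul2 (fun x y => add2 x (opp2 y)) opp2 eq.
Proof.
split=> *; by [|exact: add0r|exact: addrC|exact: addrA|exact: mul1r|exact: mulrC
  |exact: mulrA|exact: mulrDl|exact: subrr].
Qed.

Lemma char2_morph :
  Ring_theory.ring_morph zero2 one2 add2 mul2 (fun x y => add2 x (opp2 y)) opp2 eq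
    false true addb andb addb id eqb of_bool.
Proof.
split=> //.
- by case; case; rewrite /= /add2 /of_bool /one2 /zero2 ?addr0 ?add0r ?(addrr_pchar2 pchar2).
- by case; case; rewrite /= /add2 /opp2 /of_bool /one2 /zero2  ?subr0 ?sub0r ?(oppr_pchar2 pchar2) ?(addrr_pchar2 pchar2).
- by case; case; rewrite /= /mul2 /of_bool /one2 /zero2  ?mulr0 ?mulr1.
- by case; rewrite /= /opp2 /of_bool /one2 /zero2 ?oppr0 ?(oppr_pchar2 pchar2).
- by case; case.
Qed.

End CharTwoRing.

(** * The variety in coordinates over F_q *)

Section BTVariety.
Variables (F : finFieldType) (e : nat) (eps delta : F).
Hypotheses (e_ge3 : (3 <= e)%N) (e_odd : odd e).
Hypothesis cardF : #|F| = ((2 ^ e) ^ 2)%N.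
Hypothesis eps_notin : eps \notin Fq F e.
Hypothesis delta_in : delta \in Fq F e.
Hypothesis delta_neq1 : delta != 1.
Hypothesis eps_root : eps ^+ 2 + eps + delta = 0.
Notation row4 := (@row4 F).

Let q := (2 ^ e)%N.
Let s := sigma e.
Let N := e.*2.

Lemma cardF2 : #|F| = (2 ^ N)%N.
Proof. by rewrite cardF -expnM muln2. Qed.

Lemma pchar2 : 2 \in [pchar F].
Proof. exact: card_finPcharP cardF2 _. Qed.

Let addxx (x : F) : x + x = 0 := addrr_pchar2 pchar2 x.
Let eq_of_add0 := eq_of_add0_pchar2 pchar2.
Notation frob := (@frob F pchar2).

Ltac bool_cst t := match t with
 | (zero2 F) => constr:(false) | (one2 F) => constr:(true) | _ => constr:(InitialRing.NotConstant) end.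
Add Ring char2_ring : (char2_ring_theory F) (morphism (char2_morph pchar2), constants [bool_cst]).
(* Matrix entries are generalised first: the 0, 1 and + of their indices must
   not be folded. *)
Ltac gen_entries := repeat match goal with
  |- context [@fun_of_matrix ?T ?m ?n ?M ?i ?j] => move: (@fun_of_matrix T m n M i j) => ? end.
Ltac fold2 := gen_entries; rewrite ?expr2 -?[(_ + _ : F)]/(@add2 F _ _) -?[(_ * _ : F)]/(@mul2 F _ _)
     -?[(- _ : F)]/(@opp2 F _) -?[(_ ^+ _ : F)]/(@exp2 F _ _)
     -?[(0 : F)]/(zero2 F) -?[(1 : F)]/(one2 F);
   repeat match goal with |- context [@eq ?T ?a ?b] =>
      lazymatch T with (carr F) => fail | _ => change (@eq T a b) with (@eq (carr F) a b) end end.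
Ltac char2 := apply: eq_of_add0; fold2; ring.
Ltac char2_with E := apply: eq_of_add0; move: (E); fold2; let H := fresh in move=> H; ring [H].

Lemma expD_sigma (x y : F) : (x + y) ^+ s = x ^+ s + y ^+ s.
Proof. exact: exprD_pow2 pchar2 _ x y. Qed.

Lemma expD_q (x y : F) : (x + y) ^+ q = x ^+ q + y ^+ q.
Proof. exact: exprD_pow2 pchar2 _ x y. Qed.

Lemma expD2 (x y : F) : (x + y) ^+ 2 = x ^+ 2 + y ^+ 2.
Proof. exact: (exprD_pow2 pchar2 1). Qed.

Lemma sigma_gt0 : (0 < s)%N. Proof. by rewrite expn_gt0. Qed.
Lemma q_gt0 : (0 < q)%N. Proof. by rewrite expn_gt0. Qed.

Lemma e_half : e = (e./2).*2.+1.
Proof. by rewrite -[LHS]odd_double_half e_odd. Qed.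

Lemma sigmaE : s = (2 ^ (e./2).+1)%N.
Proof. by rewrite /s /sigma -uphalfE uphalf_half e_odd. Qed.

Lemma sigma_sqr : (s * s = q * 2)%N.
Proof. by rewrite sigmaE /q {3}e_half -expnD -expnSr; congr (2 ^ _)%N; lia. Qed.

Lemma sigma_bounds : (4 <= s /\ s + 4 <= q)%N.
Proof.
have h1 : (1 <= e./2)%N by move: e_ge3 e_half; lia.
have s4 : (4 <= s)%N by rewrite sigmaE (@leq_pexp2l 2 2).
split=> //; have := sigma_sqr; nia.
Qed.

Notation Fq := (Fq F e).

Lemma FqE x : (x \in Fq) = (x ^+ q == x). Proof. by rewrite inE. Qed.
Lemma FqP x : reflect (x ^+ q = x) (x \in Fq).
Proof. by rewrite FqE; apply: eqP. Qed.
Lemma Fq0 : 0 \in Fq. Proof. by apply/FqP; rewrite expr0n gtn_eqF ?q_gt0. Qed.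
Lemma Fq1 : 1 \in Fq. Proof. by apply/FqP; rewrite expr1n. Qed.
Lemma FqD x y : x \in Fq -> y \in Fq -> x + y \in Fq.
Proof. by move=> /FqP hx /FqP hy; apply/FqP; rewrite expD_q hx hy. Qed.
Lemma FqM x y : x \in Fq -> y \in Fq -> x * y \in Fq.
Proof. by move=> /FqP hx /FqP hy; apply/FqP; rewrite exprMn hx hy. Qed.
Lemma FqX x n : x \in Fq -> x ^+ n \in Fq.
Proof. by move=> /FqP hx; apply/FqP; rewrite exprAC hx. Qed.
Lemma FqV x : x \in Fq -> x^-1 \in Fq.
Proof. by move=> /FqP hx; apply/FqP; rewrite exprVn hx. Qed.
Hint Resolve Fq0 Fq1 delta_in : core.

(** On F_q the map x ^ sigma is a square root of the Frobenius map. *)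
Lemma Fq_sigma_sigma x : x \in Fq -> (x ^+ s) ^+ s = x ^+ 2.
Proof. by move=> /FqP hx; rewrite -exprM sigma_sqr exprM hx. Qed.

Lemma expqq (x : F) : (x ^+ q) ^+ q = x.
Proof. by rewrite -exprM mulnn -cardF expf_card. Qed.

(** The conjugate of eps is the other root of X ^ 2 + X + delta. *)
Lemma epsq : eps ^+ q = eps + 1.
Proof.
have /FqP dq := delta_in.
have h : (eps ^+ q) ^+ 2 + eps ^+ q + delta = 0.
  by rewrite -dq exprAC -!expD_q eps_root expr0n gtn_eqF ?q_gt0.
have : (eps ^+ q + eps) * (eps ^+ q + (eps + 1)) = 0.
  rewrite -[RHS](addxx 0) -{1}h -eps_root; char2.
move/eqP; rewrite mulf_eq0 => /orP[] /eqP/eq_of_add0 // h1.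
by case/negP: eps_notin; apply/FqP.
Qed.

Lemma eps2 : eps * eps = eps + delta.
Proof. apply: eq_of_add0; rewrite -eps_root; char2. Qed.

Lemma delta_neq0 : delta != 0.
Proof.
apply: contra eps_notin => /eqP d0; have := eps2; rewrite d0 addr0 => h.
have [->//|n0] := eqVneq eps 0.
by rewrite (_ : eps = 1) //; apply: (mulfI n0); rewrite h mulr1.
Qed.

Lemma eps_neq0 : eps != 0.
Proof. by apply: contraNneq eps_notin => ->. Qed.

Lemma eps1_neq0 : eps + 1 != 0.
Proof. by apply: contraNneq eps_notin => /eq_of_add0 ->. Qed.

Definition im (x : F) : F := x ^+ q + x.
Definition re (x : F) : F := x + im x * eps.

Lemma reim x : x = re x + im x * eps.
Proof. rewrite /re; char2. Qed.

Lemma im_in x : im x \in Fq.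
Proof. by apply/FqP; rewrite /im expD_q expqq addrC. Qed.

Lemma re_in x : re x \in Fq.
Proof.
have /FqP h := im_in x; apply/FqP.
rewrite /re expD_q exprMn h epsq /im; char2.
Qed.
Hint Resolve im_in re_in : core.
Ltac fq := repeat first [done | apply: FqD | apply: FqM | apply: FqX | apply: FqV].

Lemma im_coord a b : a \in Fq -> b \in Fq -> im (a + b * eps) = b.
Proof.
by move=> /FqP ha /FqP hb; rewrite /im expD_q exprMn ha hb epsq; char2.
Qed.

Lemma re_coord a b : a \in Fq -> b \in Fq -> re (a + b * eps) = a.
Proof. by move=> ha hb; rewrite /re im_coord //; char2. Qed.

Lemma im_Fq a : a \in Fq -> im a = 0.
Proof. by move=> ha; have := im_coord ha Fq0; rewrite mul0r addr0. Qed.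
Lemma re_Fq a : a \in Fq -> re a = a.
Proof. by move=> ha; have := re_coord ha Fq0; rewrite mul0r addr0. Qed.

Lemma imD x y : im (x + y) = im x + im y.
Proof. rewrite /im expD_q; char2. Qed.
Lemma reD x y : re (x + y) = re x + re y.
Proof. rewrite /re imD; char2. Qed.

Lemma mul_coord x y :
  x * y = (re x * re y + delta * (im x * im y))
          + (re x * im y + im x * re y + im x * im y) * eps.
Proof.
rewrite {1}(reim x) {1}(reim y); have := eps2 => h; char2_with h.
Qed.

Lemma imM x y : im (x * y) = re x * im y + im x * re y + im x * im y.
Proof. rewrite mul_coord im_coord //; fq. Qed.
Lemma reM x y : re (x * y) = re x * re y + delta * (im x * im y).
Proof. rewrite mul_coord re_coord //; fq. Qed.

Lemma imMl a x : a \in Fq -> im (a * x) = a * im x.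
Proof. by move=> ha; rewrite imM (im_Fq ha) (re_Fq ha) !mul0r !addr0. Qed.
Lemma reMl a x : a \in Fq -> re (a * x) = a * re x.
Proof. by move=> ha; rewrite reM (im_Fq ha) (re_Fq ha) !mul0r mulr0 !addr0. Qed.

Lemma im_eps : im eps = 1.
Proof. by have := im_coord Fq0 Fq1; rewrite mul1r add0r. Qed.
Lemma re_eps : re eps = 0.
Proof. by have := re_coord Fq0 Fq1; rewrite mul1r add0r. Qed.

Lemma coord_inj x y : re x = re y -> im x = im y -> x = y.
Proof. by move=> h1 h2; rewrite (reim x) (reim y) h1 h2. Qed.

Lemma im_nondeg x : (forall y, im (x * y) = 0) -> x = 0.
Proof.
move=> h; have := h 1; rewrite mulr1 => h1.
have := h eps; rewrite imM h1 im_eps re_eps !mul0r mulr1 !addr0 => h2.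
by rewrite (reim x) h1 h2 mul0r addr0.
Qed.

Lemma card_Fq : #|Fq| = q.
Proof.
suff h : (#|Fq| * #|Fq| = q * q)%N by nia.
pose f (x : F) := (re x, im x).
have fi : injective f by move=> x y [] /coord_inj; apply.
rewrite -cardsX mulnn -cardF -(card_codom fi); apply: eq_card => -[a b].
rewrite inE /=; apply/andP/codomP => [[ha hb]|[x [-> ->]]]; last by split.
by exists (a + b * eps); rewrite /f re_coord ?im_coord.
Qed.

Lemma Fq_poly0 (p : {poly F}) : (size p <= q)%N ->
  (forall t, t \in Fq -> p.[t] = 0) -> p = 0.
Proof.
move=> sp h; apply/eqP; apply/negPn/negP => p0.
have rt : all (root p) (enum Fq) by apply/allP => t; rewrite mem_enum => /h/eqP.
by have := max_poly_roots p0 rt (enum_uniq Fq); rewrite -cardE card_Fq ltnNge sp.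
Qed.

(** The coefficient comparison on which every rigidity statement below rests.
    It needs e >= 3: for e = 1 one has sigma = 2 and two exponents coincide. *)
Lemma Fq_coefs0 (k4 k3 k2 k1 k0 : F) :
  (forall t, t \in Fq ->
     k4 * (t ^+ s * t ^+ 2) + k3 * t ^+ s + k2 * t ^+ 2 + k1 * t + k0 = 0) ->
  [/\ k4 = 0, k3 = 0, k2 = 0, k1 = 0 & k0 = 0].
Proof.
have [s4 sq] := sigma_bounds.
pose p : {poly F} := k4 *: 'X^(s + 2) + k3 *: 'X^s + k2 *: 'X^2 + k1 *: 'X^1 + k0%:P.
move=> h; have p0 : p = 0.
  apply: Fq_poly0 => [|t ht]; last by rewrite /p !(hornerD, hornerZ, hornerXn, hornerC) exprD h.
  have sX k n : (n < q)%N -> (size (k *: 'X^n : {poly F}) <= q)%N.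
    by move=> ?; apply: leq_trans (size_scale_leq _ _) _; rewrite size_polyXn.
  have sD (u v : {poly F}) : (size u <= q)%N -> (size v <= q)%N -> (size (u + v)%R <= q)%N.
    by move=> ??; apply: leq_trans (size_polyD _ _) _; rewrite geq_max; apply/andP.
  rewrite /p; repeat first [apply: (sD) | apply: (sX); lia].
  by apply: leq_trans (size_polyC_leq1 _) _; lia.
have c i : p`_i = 0 by rewrite p0 coef0.
split.
- have := c (s + 2)%N; rewrite /p !(coefD, coefZ, coefXn, coefC) eqxx.
  by do 4![case: eqP => [?|_]; first lia]; rewrite mulr1 !mulr0 !addr0.
- have := c s; rewrite /p !(coefD, coefZ, coefXn, coefC) eqxx.
  by do 4![case: eqP => [?|_]; first lia]; rewrite mulr1 !mulr0 !addr0 add0r.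
- have := c 2; rewrite /p !(coefD, coefZ, coefXn, coefC) eqxx.
  by do 4![case: eqP => [?|_]; first lia]; rewrite mulr1 !mulr0 !addr0 !add0r.
- have := c 1%N; rewrite /p !(coefD, coefZ, coefXn, coefC) eqxx.
  by do 4![case: eqP => [?|_]; first lia]; rewrite mulr1 !mulr0 !addr0 !add0r.
have := c 0; rewrite /p !(coefD, coefZ, coefXn, coefC) eqxx.
by do 4![case: eqP => [?|_]; first lia]; rewrite !mulr0 !add0r.
Qed.

(** The map x ^ (sigma + 2) is injective on F_q: with z = x ^ (sigma + 2) one
    gets z ^ sigma x ^ 2 = z ^ 2, so z determines x ^ 2. *)
Lemma Fq_sigma2_inj x y : x \in Fq -> y \in Fq ->
  x ^+ s * x ^+ 2 = y ^+ s * y ^+ 2 -> x = y.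
Proof.
have key z : z \in Fq -> (z ^+ s * z ^+ 2) ^+ s * z ^+ 2 = (z ^+ s * z ^+ 2) ^+ 2.
  by move=> hz; rewrite !exprMn Fq_sigma_sigma //; char2.
move=> hx hy E; have := key x hx; rewrite E -(key y hy).
have [z0|z0] := eqVneq (y ^+ s * y ^+ 2) 0.
  have y0 (w : F) : w ^+ s * w ^+ 2 = 0 -> w = 0.
    by rewrite -exprD; apply: expr_eq0W.
  by rewrite (y0 _ z0) (y0 x) // E.
move/(mulfI (expf_neq0 s z0)) => E2; apply: eq_of_add0.
by apply: (@expr_eq0W F 2); rewrite expD2 E2 addxx.
Qed.

Notation Gamma := (Gamma e eps).

(** In the coordinates over F_q, Gamma is the form of the Suzuki-Tits ovoid. *)
Lemma GammaE x : Gamma x = re x ^+ s * re x ^+ 2 + re x * im x + im x ^+ s.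
Proof.
rewrite /Gamma -/q -/s -/(im x) -/(re x) exprD [x ^+ q.+1]exprS [(2 * q)%N]mulnC exprM.
have -> : x ^+ q = im x + x by rewrite /im; char2.
rewrite /re; char2.
Qed.

Lemma Gamma_in x : Gamma x \in Fq.
Proof. by rewrite GammaE; fq. Qed.

Lemma Gamma_shift x d t : t \in Fq ->
  Gamma (x + t * d) =
    re d ^+ s * re d ^+ 2 * (t ^+ s * t ^+ 2)
  + (re d ^+ s * re x ^+ 2 + im d ^+ s) * t ^+ s
  + (re d ^+ 2 * re x ^+ s + re d * im d) * t ^+ 2
  + (re x * im d + re d * im x) * t + Gamma x.
Proof.
move=> ht; rewrite !GammaE reD imD reMl // imMl //.
move: (re x) (im x) (re d) (im d) => a b c f.
by rewrite !expD_sigma !expD2 !exprMn; char2.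
Qed.

(** The equations given by the coefficients of t ^ (sigma + 2), t ^ sigma and t
    when the points x + t d, for t in F_q, are on the variety. *)
Definition subline_rel x1 x2 d1 d2 d3 :=
  [/\ re d1 = re d2,
      re d1 ^+ s * (re x1 + re x2) ^+ 2 = (im d1 + im d2) ^+ s
    & im d3 = re x1 * im d1 + re x2 * im d2 + re d1 * (im x1 + im x2)].

Lemma affine_subline x1 x2 x3 d1 d2 d3 :
  (forall t, t \in Fq ->
     im (x3 + t * d3) = Gamma (x1 + t * d1) + Gamma (x2 + t * d2)) ->
  subline_rel x1 x2 d1 d2 d3.
Proof.
move=> h.
have := @Fq_coefs0 (re d1 ^+ s * re d1 ^+ 2 + re d2 ^+ s * re d2 ^+ 2)
  (re d1 ^+ s * re x1 ^+ 2 + im d1 ^+ s + (re d2 ^+ s * re x2 ^+ 2 + im d2 ^+ s))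
  (re d1 ^+ 2 * re x1 ^+ s + re d1 * im d1 + (re d2 ^+ 2 * re x2 ^+ s + re d2 * im d2))
  (re x1 * im d1 + re d1 * im x1 + (re x2 * im d2 + re d2 * im x2) + im d3)
  (Gamma x1 + Gamma x2 + im x3).
case=> [t ht|k4 k3 _ k1 _].
  have := h t ht; rewrite imD imMl // !Gamma_shift // => h'.
  by rewrite -[RHS](addxx (im x3 + t * im d3)) {1}h'; char2.
have E := Fq_sigma2_inj (re_in d1) (re_in d2) (eq_of_add0 k4).
rewrite -E in k3 k1 *; split=> //; apply: eq_of_add0.
  by rewrite (expD_sigma (im d1)) expD2 -k3; char2.
by rewrite -k1; char2.
Qed.

(** * The cone over the variety and its distinguished point *)

(** The affine cone over the variety, zero vector included; the point spanned
    by a nonzero v is on the variety if and only if inH v holds. *)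
Definition inH (v : 'rV[F]_4) : bool :=
  if v 0 0 == 0 then v 0 1 ^+ q.+1 + v 0 2 ^+ q.+1 == 0
  else im (v 0 3 / v 0 0) == Gamma (v 0 1 / v 0 0) + Gamma (v 0 2 / v 0 0).

Lemma inH_affine x1 x2 x3 :
  inH (row4 1 x1 x2 x3) = (im x3 == Gamma x1 + Gamma x2).
Proof. by rewrite /inH !row4E oner_eq0 !divr1. Qed.

Lemma inH_infty x1 x2 x3 :
  inH (row4 0 x1 x2 x3) = (x1 ^+ q.+1 + x2 ^+ q.+1 == 0).
Proof. by rewrite /inH !row4E eqxx. Qed.

Lemma inHZ c v : c != 0 -> inH (c *: v) = inH v.
Proof.
move=> c0; rewrite /inH !mxE mulf_eq0 (negPf c0) /= -!mulf_div !divff // !mul1r.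
by rewrite !exprMn -mulrDr mulf_eq0 expf_eq0 (negPf c0) andbF.
Qed.

Lemma BT_mem (P : point F) v : v \in pset P -> v != 0 ->
  (P \in BT_variety e eps) = inH v.
Proof.
move=> vP v0; have PE := pset_line vP v0.
have memP u : u \in pset P -> u != 0 -> inH u = inH v.
  rewrite PE => /imsetP[a _ ->]; rewrite scaler_eq0 negb_or => /andP[a0 _].
  by rewrite inHZ.
rewrite inE; apply/orP/idP => [[]|].
- move=> /existsP[x1 /existsP[x2 /existsP[x3 /andP[uP hu]]]].
  rewrite -(memP _ uP) ?inH_affine //.
  by apply/eqP => /rowP/(_ 0); rewrite row4E mxE; apply/eqP; rewrite oner_eq0.
- move=> /existsP[x1 /existsP[x2 /existsP[x3 /and3P[u0 uP hu]]]].
  by rewrite -(memP _ uP) ?inH_infty.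
rewrite {1}(row4_eta v); have [v00|v00] := eqVneq (v 0 0) 0.
  rewrite v00 inH_infty => hv; right.
  apply/existsP; exists (v 0 1); apply/existsP; exists (v 0 2).
  by apply/existsP; exists (v 0 3); rewrite hv andbT -v00 -row4_eta v0.
have vE : (v 0 0)^-1 *: v =
    row4 1 ((v 0 0)^-1 * v 0 1) ((v 0 0)^-1 * v 0 2) ((v 0 0)^-1 * v 0 3).
  by rewrite {2}(row4_eta v) row4Z mulVf.
rewrite -row4_eta -(inHZ v (invr_neq0 v00)) vE inH_affine => hv; left.
apply/existsP; exists ((v 0 0)^-1 * v 0 1).
apply/existsP; exists ((v 0 0)^-1 * v 0 2).
apply/existsP; exists ((v 0 0)^-1 * v 0 3); rewrite hv andbT -vE PE.
by apply/imsetP; exists (v 0 0)^-1.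
Qed.

(** The lines joining p to the points of the variety all carry a subline over
    F_q, with p as its point at infinity, that lies in the variety.  The scalar
    m, which fixes the scale of that subline, may depend on v. *)
Definition baer_vertex (p : 'rV[F]_4) := forall v, inH v ->
  exists2 m, m != 0 & forall t, t \in Fq -> inH (v + (t * m) *: p).

Lemma baer_vertexZ c p : c != 0 -> baer_vertex p -> baer_vertex (c *: p).
Proof.
move=> c0 hp v /hp[m m0 hm]; exists (m / c); first by rewrite mulf_neq0 ?invr_neq0.
by move=> t /hm; rewrite scalerA -mulrA divfK.
Qed.

Lemma baer_vertex_e3 : baer_vertex (row4 0 0 0 1).
Proof.
move=> v; rewrite (row4_eta v); move: (v 0 0) (v 0 1) (v 0 2) (v 0 3) => a b c d hv.
have [a0|a0] := eqVneq a 0.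
  exists 1 => [|t _]; first exact: oner_neq0.
  by move: hv; rewrite a0 row4Z row4D !mulr0 !addr0 !inH_infty.
exists a => // t ht; rewrite -(inHZ _ (invr_neq0 a0)) in hv.
rewrite -(inHZ _ (invr_neq0 a0)) row4Z row4D !mulr0 !addr0.
move: hv; rewrite !row4Z mulVf // !inH_affine mulr1 mulrDr imD => /eqP->.
by rewrite mulrCA mulVf // mulr1 im_Fq // addr0.
Qed.

Lemma baer_vertex_infty p1 p2 p3 x1 x2 x3 : baer_vertex (row4 0 p1 p2 p3) ->
  im x3 = Gamma x1 + Gamma x2 ->
  exists2 m, m != 0 & subline_rel x1 x2 (m * p1) (m * p2) (m * p3).
Proof.
move=> hp /eqP; rewrite -inH_affine => /hp[m m0 hm]; exists m => //.
apply: (affine_subline (x3 := x3)) => t /hm.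
by rewrite row4Z row4D mulr0 addr0 inH_affine -!mulrA => /eqP.
Qed.

(** Here p is affine and v is at infinity, so the subline is read from its
    other end: v + t m p is proportional to p + t^-1 m^-1 v, and the value t = 0
    is replaced by the fact that p itself is on the variety. *)
Lemma baer_vertex_affine p1 p2 p3 v1 v2 v3 : baer_vertex (row4 1 p1 p2 p3) ->
  v1 ^+ q.+1 = v2 ^+ q.+1 ->
  exists2 m, m != 0 & subline_rel p1 p2 (m * v1) (m * v2) (m * v3).
Proof.
move=> hp hv.
have pH : im p3 = Gamma p1 + Gamma p2.
  have [|m m0 hm] := hp (row4 0 0 0 0); first by rewrite inH_infty expr0n addr0.
  by have := hm 1 Fq1; rewrite row4_00 add0r mul1r inHZ // inH_affine => /eqP.
have [|m m0 hm] := hp (row4 0 v1 v2 v3); first by rewrite inH_infty hv addxx.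
exists m^-1; first by rewrite invr_eq0.
apply: (affine_subline (x3 := p3)) => t ht.
have [->|t0] := eqVneq t 0; first by rewrite !mul0r !addr0.
have c0 : t / m != 0 by rewrite mulf_neq0 ?invr_eq0.
have c1 : t / m * (t^-1 * m) = 1 by rewrite mulrACA divff // mulVf // mulr1.
have cE v p : t / m * (v + t^-1 * m * p) = p + t * (m^-1 * v).
  by rewrite mulrDr [X in _ + X]mulrA c1 mul1r addrC -mulrA.
have := hm t^-1 (FqV ht); rewrite -(inHZ _ c0) row4Z row4D row4Z !cE !mulr0 addr0.
by rewrite inH_affine => /eqP.
Qed.

Lemma norm_eps : eps ^+ q.+1 = delta.
Proof. by rewrite exprS epsq mulrDr mulr1 eps2; char2. Qed.

Lemma norm_eps1 : (eps + 1) ^+ q.+1 = delta.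
Proof. by rewrite exprS expD_q expr1n epsq -norm_eps exprS epsq; char2. Qed.

Lemma im0 : im 0 = 0. Proof. exact: im_Fq. Qed.
Lemma re0 : re 0 = 0. Proof. exact: re_Fq. Qed.
Lemma expr0_sigma : (0 : F) ^+ s = 0. Proof. by rewrite expr0n gtn_eqF ?sigma_gt0. Qed.
Lemma Gamma0 : Gamma 0 = 0.
Proof. by rewrite GammaE im0 re0 expr0_sigma !mul0r !addr0. Qed.

(** Testing against the origin gives p1 = p2.  If they were not zero, testing
    against (1, g, 0, Gamma g eps) would give im (eps p3 / p1) = g for two
    different nonzero g, namely 1 and delta. *)
Lemma baer_vertex_infty_e3 p1 p2 p3 : baer_vertex (row4 0 p1 p2 p3) -> p1 = 0 /\ p2 = 0.
Proof.
move=> hp; have p12 : p1 = p2.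
  have [|m m0 [h1 h2 _]] := baer_vertex_infty (x1 := 0) (x2 := 0) (x3 := 0) hp.
    by rewrite im0 Gamma0 addr0.
  apply: (mulfI m0); apply: coord_inj => //; apply: eq_of_add0.
  by apply: (@expr_eq0W F s); rewrite -h2 re0 addr0 expr0n mulr0.
rewrite -{p2}p12 in hp *; have [->//|p10] := eqVneq p1 0; exfalso.
(* the witness (1, g, 0, Gamma g eps), for which re x1 + re x2 = g *)
have key g : g \in Fq -> g != 0 -> im (eps * p3 / p1) = g.
  move=> hg g0; have hx : im (Gamma g * eps) = Gamma g + Gamma 0.
    by rewrite Gamma0 addr0 -[_ * eps]add0r im_coord // Gamma_in.
  have [m m0 [_ h2 h4]] := baer_vertex_infty hp hx.
  have r0 : re (m * p1) = 0.
    move: h2; rewrite addxx expr0_sigma re0 addr0 (re_Fq hg) => /eqP.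
    by rewrite mulf_eq0 (negPf (expf_neq0 2 g0)) orbF => /eqP/expr_eq0W.
  have dE : m * p1 = im (m * p1) * eps by rewrite {1}[m * p1]reim r0 add0r.
  have d0 : im (m * p1) != 0.
    by apply/eqP => z; move: dE; rewrite z mul0r => /eqP; rewrite mulf_eq0 (negPf m0) (negPf p10).
  apply: (mulfI d0); rewrite -imMl // !mulrA -dE mulrAC mulfK //.
  by rewrite h4 r0 re0 (re_Fq hg) !mul0r !addr0 mulrC.
have := key delta delta_in delta_neq0; rewrite (key 1 Fq1 (oner_neq0 _)) => d1.
by case/eqP: delta_neq1; rewrite -d1.
Qed.

(** Testing against (0, 1, c, v) with c = eps / (eps + 1), which has norm 1,
    determines the scalar m up to a factor in F_q; then delta * im v has to take
    the same value for v = 0 and for v = eps. *)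
Lemma baer_vertex_affine_absurd p1 p2 p3 : ~ baer_vertex (row4 1 p1 p2 p3).
Proof.
move=> hp.
(* an element of norm 1 other than 1 *)
pose c := (eps + 1)^-1 * eps.
have hc : 1 ^+ q.+1 = c ^+ q.+1.
  by rewrite expr1n exprMn exprVn norm_eps norm_eps1 mulVf ?delta_neq0.
have key v : delta * im v = re p2 + delta * (im p1 + im p2).
  have [m m0 [h1 _ h4]] := baer_vertex_affine v hp hc; rewrite mulr1 in h1 h4.
  pose n := im m + im (m * c).
  have n_in : n \in Fq by apply: FqD.
  have cE : (eps + 1) * c = eps by rewrite mulrA divff ?mul1r ?eps1_neq0.
  (* re m = re (m c), so m (1 + c) is in F_q eps, and 1 + c = 1 / (eps + 1) *)
  have mE : m = n * delta.
    have E : m + m * c = n * eps.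
      by rewrite (reim (m + m * c)) reD imD -/n h1 addxx add0r.
    have -> : m = (m + m * c) * (eps + 1) by rewrite mulrDl -mulrA [c * _]mulrC cE; char2.
    by rewrite E; have e2 := eps2; char2_with e2.
  have n0 : n != 0 by apply: contraNneq m0 => z; rewrite mE z mul0r.
  have m_in : m \in Fq by rewrite mE; apply: FqM.
  apply: (mulfI n0); rewrite mulrA -mE -imMl // h4.
  have -> : im m = 0 by apply: im_Fq.
  have -> : im (m * c) = n by rewrite /n (im_Fq m_in) add0r.
  by rewrite (re_Fq m_in) mE; char2.
have := key 0; rewrite -(key eps) im0 im_eps mulr0 mulr1 => /eqP.
by rewrite eq_sym (negPf delta_neq0).
Qed.

Lemma baer_vertex_uniq p : p != 0 -> baer_vertex p -> p = row4 0 0 0 (p 0 3).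
Proof.
move=> p0 hp; rewrite (row4_eta p) in hp.
have [p00|p00] := eqVneq (p 0 0) 0.
  rewrite p00 in hp; have [p1 p2] := baer_vertex_infty_e3 hp.
  by rewrite {1}(row4_eta p) p00 p1 p2.
have := baer_vertexZ (invr_neq0 p00) hp; rewrite row4Z mulVf //.
by move/baer_vertex_affine_absurd.
Qed.

(** * Affine maps that preserve the variety *)

(** An affine map fixing the point (0,0,0,1), written out in coordinates. *)
Section Rigidity.
Variables (p1 p2 p3 a11 a12 a21 a22 b1 b2 m : F).
Hypothesis m0 : m != 0.

Let L1 d1 d2 := a11 * d1 + a21 * d2.
Let L2 d1 d2 := a12 * d1 + a22 * d2.

Hypothesis keepsH : forall x1 x2 x3, im x3 = Gamma x1 + Gamma x2 ->
  im (p3 + (b1 * x1 + b2 * x2) + m * x3)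
    = Gamma (p1 + L1 x1 x2) + Gamma (p2 + L2 x1 x2).

(** The variety is invariant under adding elements of F_q to x3. *)
Lemma rigid_m_in : m \in Fq.
Proof.
have h x : im x = 0 -> im p3 + im (m * x) = Gamma p1 + Gamma p2.
  move=> hx; have := @keepsH 0 0 x.
  by rewrite /L1 /L2 Gamma0 !mulr0 !addr0 -imD => ->.
have : im p3 + im (m * 1) = im p3 + im (m * 0) by rewrite !h // im_Fq.
by rewrite mulr0 mulr1 im0 => /addrI h0; rewrite (reim m) h0 mul0r addr0.
Qed.

(** Let (x1, x2) run over the points y + t d and take for x3 the value in F_q eps
    that lies on the variety.  Then [keepsH] is a polynomial identity in t; these
    are its coefficients of t ^ (sigma + 2), t ^ sigma, t and 1. *)
Lemma rigid_coefs d1 d2 y1 y2 :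
  let l1 := L1 d1 d2 in let l2 := L2 d1 d2 in
  let z1 := p1 + L1 y1 y2 in let z2 := p2 + L2 y1 y2 in
  [/\ re l1 ^+ s * re l1 ^+ 2 + re l2 ^+ s * re l2 ^+ 2
        = m * (re d1 ^+ s * re d1 ^+ 2 + re d2 ^+ s * re d2 ^+ 2),
      re l1 ^+ s * re z1 ^+ 2 + re l2 ^+ s * re z2 ^+ 2 + (im l1 + im l2) ^+ s
        = m * (re d1 ^+ s * re y1 ^+ 2 + re d2 ^+ s * re y2 ^+ 2
               + (im d1 + im d2) ^+ s),
      re z1 * im l1 + re l1 * im z1 + (re z2 * im l2 + re l2 * im z2)
        = im (b1 * d1 + b2 * d2)
          + m * (re y1 * im d1 + re d1 * im y1 + (re y2 * im d2 + re d2 * im y2))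
    & Gamma z1 + Gamma z2
        = im (p3 + (b1 * y1 + b2 * y2)) + m * (Gamma y1 + Gamma y2)].
Proof.
move=> l1 l2 z1 z2.
have := @Fq_coefs0
  (re l1 ^+ s * re l1 ^+ 2 + re l2 ^+ s * re l2 ^+ 2
   + m * (re d1 ^+ s * re d1 ^+ 2 + re d2 ^+ s * re d2 ^+ 2))
  (re l1 ^+ s * re z1 ^+ 2 + im l1 ^+ s + (re l2 ^+ s * re z2 ^+ 2 + im l2 ^+ s)
   + m * (re d1 ^+ s * re y1 ^+ 2 + im d1 ^+ s
          + (re d2 ^+ s * re y2 ^+ 2 + im d2 ^+ s)))
  (re l1 ^+ 2 * re z1 ^+ s + re l1 * im l1 + (re l2 ^+ 2 * re z2 ^+ s + re l2 * im l2)
   + m * (re d1 ^+ 2 * re y1 ^+ s + re d1 * im d1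
          + (re d2 ^+ 2 * re y2 ^+ s + re d2 * im d2)))
  (re z1 * im l1 + re l1 * im z1 + (re z2 * im l2 + re l2 * im z2)
   + im (b1 * d1 + b2 * d2)
   + m * (re y1 * im d1 + re d1 * im y1 + (re y2 * im d2 + re d2 * im y2)))
  (Gamma z1 + Gamma z2 + im (p3 + (b1 * y1 + b2 * y2)) + m * (Gamma y1 + Gamma y2)).
case=> [t ht|k4 k3 _ k1 k0].
  (* the point of the variety above (y1 + t d1, y2 + t d2) with re x3 = 0 *)
  have hG : im ((Gamma (y1 + t * d1) + Gamma (y2 + t * d2)) * eps)
            = Gamma (y1 + t * d1) + Gamma (y2 + t * d2).
    by rewrite -[_ * eps]add0r im_coord //; apply: FqD; apply: Gamma_in.
  have := keepsH hG; rewrite imD (imMl _ rigid_m_in) hG.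
  have -> : p1 + L1 (y1 + t * d1) (y2 + t * d2) = z1 + t * l1.
    by rewrite /z1 /l1 /L1; char2.
  have -> : p2 + L2 (y1 + t * d1) (y2 + t * d2) = z2 + t * l2.
    by rewrite /z2 /l2 /L2; char2.
  have -> : p3 + (b1 * (y1 + t * d1) + b2 * (y2 + t * d2))
          = p3 + (b1 * y1 + b2 * y2) + t * (b1 * d1 + b2 * d2) by char2.
  rewrite imD (imMl _ ht) !Gamma_shift // => E.
  rewrite -[RHS](addxx (im (p3 + (b1 * y1 + b2 * y2)) + t * im (b1 * d1 + b2 * d2)
     + m * (Gamma (y1 + t * d1) + Gamma (y2 + t * d2)))).
  rewrite !Gamma_shift // {1}E; char2.
split; apply: eq_of_add0.
- by rewrite -k4.
- by rewrite (expD_sigma (im l1)) (expD_sigma (im d1)) -k3; char2.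
- by rewrite -k1; char2.
by rewrite -k0; char2.
Qed.

(** The coefficient of t ^ sigma, from which the contribution of the translation
    part is removed by subtracting its value at y = 0. *)
Lemma rigid_polar d1 d2 y1 y2 :
  re (L1 d1 d2) ^+ s * re (L1 y1 y2) ^+ 2 + re (L2 d1 d2) ^+ s * re (L2 y1 y2) ^+ 2
    = m * (re d1 ^+ s * re y1 ^+ 2 + re d2 ^+ s * re y2 ^+ 2).
Proof.
have [_ h _ _] := rigid_coefs d1 d2 y1 y2.
have [_ h' _ _] := rigid_coefs d1 d2 0 0.
have L10 : L1 0 0 = 0 by rewrite /L1 !mulr0 addr0.
have L20 : L2 0 0 = 0 by rewrite /L2 !mulr0 addr0.
move: h h'; rewrite L10 L20 !reD re0 !addr0 (expD2 (re p1)) (expD2 (re p2)) expr0n !mulr0 !addr0 add0r.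
move=> h h'; apply: eq_of_add0; rewrite -[RHS](addxx (m * (im d1 + im d2) ^+ s)).
rewrite -{1}h' -[RHS]addr0.
rewrite -[in RHS](addxx (m * (re d1 ^+ s * re y1 ^+ 2 + re d2 ^+ s * re y2 ^+ 2
               + (im d1 + im d2) ^+ s))) -{1}h; char2.
Qed.

(** For d1, d2 in the kernel of re the form of [rigid_polar] vanishes at (d, d),
    so re L1 = re L2 at d; if that common value were not zero, re L1 and re L2
    would coincide everywhere and the form would vanish identically. *)
Lemma rigid_re0 d1 d2 : re d1 = 0 -> re d2 = 0 ->
  re (L1 d1 d2) = 0 /\ re (L2 d1 d2) = 0.
Proof.
move=> r1 r2.
have pol y1 y2 : re (L1 d1 d2) ^+ s * re (L1 y1 y2) ^+ 2
                 = re (L2 d1 d2) ^+ s * re (L2 y1 y2) ^+ 2.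
  by apply: eq_of_add0; rewrite rigid_polar r1 r2 expr0_sigma !mul0r addr0 mulr0.
have E := Fq_sigma2_inj (re_in _) (re_in _) (pol d1 d2).
rewrite -E in pol *; have [->//|u0] := eqVneq (re (L1 d1 d2)) 0.
have sq y1 y2 : re (L1 y1 y2) ^+ 2 = re (L2 y1 y2) ^+ 2.
  exact: (mulfI (expf_neq0 s u0)) (pol y1 y2).
have sqE y1 y2 : re (L1 y1 y2) = re (L2 y1 y2).
  by apply: eq_of_add0; apply: (@expr_eq0W F 2); rewrite expD2 sq addxx.
have := rigid_polar 1 0 1 0; rewrite sqE addxx re0 (re_Fq Fq1) expr0_sigma mul0r addr0.
by rewrite !expr1n !mulr1 => /esym/eqP; rewrite (negPf m0).
Qed.

Lemma rigid_in : [/\ a11 \in Fq, a12 \in Fq, a21 \in Fq & a22 \in Fq].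
Proof.
have key a : re (a * eps) = 0 -> a \in Fq.
  rewrite reM re_eps im_eps mulr0 add0r mulr1 => /eqP.
  by rewrite mulf_eq0 (negPf delta_neq0) => /eqP h; rewrite (reim a) h mul0r addr0.
have [] := rigid_re0 re_eps re0; rewrite /L1 /L2 !mulr0 !addr0 => h1 h2.
have [] := rigid_re0 re0 re_eps; rewrite /L1 /L2 !mulr0 !add0r => h3 h4.
by split; apply: key.
Qed.

(** The relations e12 and e21 of the proof are exchanged by swapping the indices.
    Applying sigma to one and substituting the other leaves
    a12 ^ sigma a22 ^ 2 (a11 ^ sigma + a12 ^ sigma) = 0; the third factor cannot
    vanish, since e11 would then give m = 0. *)
Lemma rigid_monomial :
  [/\ a12 = 0, a21 = 0 & a11 = a22] \/ [/\ a11 = 0, a22 = 0 & a12 = a21].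
Proof.
have [i11 i12 i21 i22] := rigid_in.
have P d1 d2 y1 y2 : d1 \in Fq -> d2 \in Fq -> y1 \in Fq -> y2 \in Fq ->
    L1 d1 d2 ^+ s * L1 y1 y2 ^+ 2 + L2 d1 d2 ^+ s * L2 y1 y2 ^+ 2
    = m * (d1 ^+ s * y1 ^+ 2 + d2 ^+ s * y2 ^+ 2).
  move=> h1 h2 h3 h4; have := rigid_polar d1 d2 y1 y2.
  by rewrite !re_Fq //; rewrite /L1 /L2; fq.
have := P 1 0 1 0 Fq1 Fq0 Fq1 Fq0; have := P 1 0 0 1 Fq1 Fq0 Fq0 Fq1.
have := P 0 1 1 0 Fq0 Fq1 Fq1 Fq0; have := P 0 1 0 1 Fq0 Fq1 Fq0 Fq1.
have s0 := expr0_sigma; have z0 : (0 : F) ^+ 2 = 0 by rewrite expr0n.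
rewrite /L1 /L2 {P} !(s0, z0, expr1n, mulr0, mul0r, mulr1, mul1r, addr0, add0r).
move=> e22 e21 e12 e11.
have /eqP : a12 ^+ s * a22 ^+ 2 * (a11 ^+ s + a12 ^+ s) = 0.
  have := congr1 (fun z => z ^+ s) (eq_of_add0 e21).
  rewrite !exprMn !Fq_sigma_sigma // => E2; have E1 := eq_of_add0 e12.
  transitivity (a21 ^+ 2 * (a11 ^+ 2) ^+ s + a22 ^+ 2 * (a12 ^+ 2) ^+ s); last first.
    by rewrite !expr2 !exprMn -!expr2 -?E2 ?addxx.
  by rewrite mulrDr -{1}E1 !expr2 !exprMn; char2.
have sq0 (a b : F) : b != 0 -> b ^+ s * a ^+ 2 = 0 -> a = 0.
  by move=> b0 /eqP; rewrite mulf_eq0 (negPf (expf_neq0 s b0)) => /eqP/expr_eq0W.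
have nz (a b : F) : a = 0 -> b ^+ s * b ^+ 2 + a ^+ s * a ^+ 2 = m -> b != 0.
  by move=> a0; apply: contra_eqN => /eqP->; rewrite a0 s0 !mul0r addr0 eq_sym m0.
rewrite mulf_eq0 => /orP[|/eqP]; first rewrite mulf_eq0 => /orP[]/eqP.
- move/expr_eq0W => a0; have b0 := nz _ _ a0 e11.
  rewrite a0 s0 mul0r addr0 in e12; rewrite a0 s0 mul0r addr0 in e11.
  have c0 := sq0 _ _ b0 e12; left; split=> //; apply: Fq_sigma2_inj => //.
  by rewrite e11 -e22 c0 s0 mul0r add0r.
- move/expr_eq0W => a0; have b0 := nz _ _ a0 e22.
  rewrite a0 z0 mulr0 addr0 in e12; rewrite a0 s0 mul0r addr0 in e22.
  have c0 : a11 = 0.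
    apply/eqP; apply: contraNT b0 => c0; apply/eqP; exact: sq0 c0 e12.
  right; split=> //; apply: Fq_sigma2_inj => //.
  by rewrite e22 -e11 c0 s0 mul0r add0r.
rewrite -expD_sigma => /expr_eq0W/eq_of_add0 h; case/eqP: m0.
by rewrite -e11 h addxx.
Qed.

(** The coefficient of t ^ (sigma + 2) gives m = a11 ^ (sigma + 2), and that of
    t ^ sigma in a direction where re vanishes gives m = a11 ^ sigma; so both
    scalars are 1.  The other coefficients then express everything through the
    translation part. *)
Lemma rigid_diag : a12 = 0 -> a21 = 0 -> a11 = a22 ->
  [/\ a11 = 1, m = 1, p1 = im p1 * eps, p2 = im p2 * eps &
   [/\ b1 = im p1 + im p1 * eps, b2 = im p2 + im p2 * eps
     & im p3 = (im p1 + im p2) ^+ s]].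
Proof.
move=> z12 z21 h22; have [i11 _ _ _] := rigid_in.
have L1E d1 d2 : L1 d1 d2 = a11 * d1 by rewrite /L1 z21 mul0r addr0.
have L2E d1 d2 : L2 d1 d2 = a11 * d2 by rewrite /L2 z12 mul0r add0r h22.
have rimE := (reMl, imMl).
have s0 := expr0_sigma; have z0 : (0 : F) ^+ 2 = 0 by rewrite expr0n.
have am : m = a11 ^+ s * a11 ^+ 2.
  have [h _ _ _] := rigid_coefs 1 0 0 0; move: h; rewrite !L1E !L2E mulr1 mulr0.
  by rewrite (re_Fq i11) re0 (re_Fq Fq1) s0 !expr1n !mul0r !addr0 !mulr1.
have as1 : a11 ^+ s = m.
  have [_ h _ _] := rigid_coefs eps 0 0 0; move: h; rewrite !L1E !L2E !mulr0.
  by rewrite !rimE // re_eps im_eps re0 im0 mulr0 s0 !mul0r !addr0 !add0r !mulr1 expr1n mulr1.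
have a1 : a11 = 1.
  have h : a11 ^+ 2 = 1.
    have ms : a11 ^+ s != 0 by rewrite as1.
    by apply: (mulfI ms); rewrite mulr1 -am.
  by apply: eq_of_add0; apply: (@expr_eq0W F 2); rewrite expD2 h expr1n addxx.
have m1 : m = 1 by rewrite -as1 a1 expr1n.
have r1 : re p1 = 0.
  have [_ h _ _] := rigid_coefs 1 0 0 0; move: h.
  rewrite !L1E !L2E a1 m1 !mul1r !(re_Fq Fq1) !(im_Fq Fq1) re0 im0 s0 z0 !addr0 s0.
  by rewrite !expr1n !mul0r mulr0 !mul1r !addr0 => /expr_eq0W.
have r2 : re p2 = 0.
  have [_ h _ _] := rigid_coefs 0 1 0 0; move: h.
  rewrite !L1E !L2E a1 m1 !mul1r !(re_Fq Fq1) !(im_Fq Fq1) re0 im0 s0 z0 !addr0 s0.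
  by rewrite !expr1n !mul0r mulr0 !mul1r !addr0 !add0r => /expr_eq0W.
have bE p b : (forall d, re d * im p = im (b * d)) -> b = im p + im p * eps.
  move=> h; apply: eq_of_add0; apply: im_nondeg => d.
  rewrite mulrDl imD -h [X in _ + X]imM re_coord // im_coord //; char2.
have b1E : b1 = im p1 + im p1 * eps.
  apply: bE => d; have [_ _ h _] := rigid_coefs d 0 0 0; move: h.
  rewrite !L1E !L2E a1 m1 !mul1r !mulr0 !addr0 r1 r2 re0 im0.
  by rewrite !(mul0r, mulr0, addr0, add0r).
have b2E : b2 = im p2 + im p2 * eps.
  apply: bE => d; have [_ _ h _] := rigid_coefs 0 d 0 0; move: h.
  rewrite !L1E !L2E a1 m1 !mul1r !mulr0 !addr0 r1 r2 re0 im0.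
  by rewrite !(mul0r, mulr0, addr0, add0r).
split=> //; first by rewrite {1}(reim p1) r1 add0r.
  by rewrite {1}(reim p2) r2 add0r.
split=> //; have [_ _ _ h] := rigid_coefs 0 0 0 0; move: h.
rewrite !L1E !L2E !mulr0 !addr0 Gamma0 addr0 mulr0 addr0 !GammaE r1 r2 => <-.
by rewrite s0 !mul0r !add0r expD_sigma.
Qed.
End Rigidity.

(** * Projectivities that preserve the variety *)

Section LinearCollineation.
Variable A : 'M[F]_4.
Hypothesis uA : A \in unitmx.
Hypothesis keeps : forall v, inH (v *m A) = inH v.

Lemma baer_vertex_mul p : baer_vertex p -> baer_vertex (p *m A).
Proof.
move=> hp v hv; have [|m m0 hm] := hp (v *m invmx A); first by rewrite -keeps mulmxKV.
exists m => // t ht; rewrite -[v](mulmxKV uA) scalemxAl -mulmxDl keeps; exact: hm.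
Qed.

(** The condition [baer_vertex] is invariant and characterises the point. *)
Lemma fixes_vertex : [/\ A 3 0 = 0, A 3 1 = 0, A 3 2 = 0 & A 3 3 != 0].
Proof.
pose p := row4 0 0 0 1 *m A.
have pE j : p 0 j = A 3 j by rewrite mulmx4 !row4E !mul0r mul1r !add0r.
have p0 : p != 0.
  apply/eqP => z; have : row4 0 0 0 1 = 0 by rewrite -[LHS](mulmxK uA) -/p z mul0mx.
  by move/rowP/(_ 3)/eqP; rewrite row4E mxE oner_eq0.
have := baer_vertex_uniq p0 (baer_vertex_mul baer_vertex_e3); move=> pr.
have h j : A 3 j = row4 0 0 0 (p 0 3) 0 j by rewrite -pr pE.
split; first by rewrite h row4E.
- by rewrite h row4E.
- by rewrite h row4E.
by apply: contraNneq p0 => z; rewrite pr pE z row4_00.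
Qed.

(** For c of norm 1 the line joining (0,0,0,1) to (0,1,c,0) lies in the variety,
    whereas im is not constant on a line through (0,0,0,1) that leaves the plane
    X0 = 0.  Two values of c, namely 1 and eps / (eps + 1), then suffice to
    kill A 1 0 and A 2 0. *)
Lemma fixes_infty : [/\ A 0 0 != 0, A 1 0 = 0 & A 2 0 = 0].
Proof.
have [a0 a1 a2 a3] := fixes_vertex.
have key c : 1 ^+ q.+1 = c ^+ q.+1 -> A 1 0 + c * A 2 0 = 0.
  move=> hc; pose w := row4 0 1 c 0 *m A.
  have w0 : w 0 0 = A 1 0 + c * A 2 0.
    by rewrite mulmx4 !row4E !(mul0r, mul1r, add0r, addr0).
  rewrite -w0; apply/eqP/negPn/negP => n0.
  (* the image of a line of the variety through the distinguished point *)
  have h t : inH (row4 (w 0 0) (w 0 1) (w 0 2) (w 0 3 + t * A 3 3)).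
    have -> : row4 (w 0 0) (w 0 1) (w 0 2) (w 0 3 + t * A 3 3) = row4 0 1 c t *m A.
      by apply: row4_ext; rewrite /w !mulmx4 !row4E ?a0 ?a1 ?a2 !mul0r ?mulr0 ?addr0.
    by rewrite keeps inH_infty hc addxx.
  have h' t : im ((w 0 3 + t * A 3 3) / w 0 0)
            = Gamma (w 0 1 / w 0 0) + Gamma (w 0 2 / w 0 0).
    by have := h t; rewrite /inH !row4E (negPf n0) => /eqP.
  have := h' (w 0 0 * eps / A 3 3); rewrite -(h' 0) mul0r addr0 divfK //.
  rewrite mulrDl imD mulrAC divff // mul1r im_eps => /eqP.
  by rewrite -subr_eq0 addrAC subrr add0r oner_eq0.
have h1 := key 1 erefl.
have /key h2 : 1 ^+ q.+1 = ((eps + 1)^-1 * eps) ^+ q.+1.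
  by rewrite expr1n exprMn exprVn norm_eps norm_eps1 mulVf ?delta_neq0.
have z2 : A 2 0 = 0.
  have : (1 + (eps + 1)^-1 * eps) * A 2 0 = 0.
    transitivity ((A 1 0 + 1 * A 2 0) + (A 1 0 + (eps + 1)^-1 * eps * A 2 0)); first by char2.
    by rewrite h1 h2 addxx.
  move/eqP; rewrite mulf_eq0 => /orP[|/eqP //].
  have -> : 1 + (eps + 1)^-1 * eps = (eps + 1)^-1.
    by apply: (mulfI eps1_neq0); rewrite mulrDr mulrA divff ?eps1_neq0 // mul1r; char2.
  by rewrite invr_eq0 (negPf eps1_neq0).
have z1 : A 1 0 = 0 by have := h1; rewrite z2 mulr0 addr0.
split=> //; apply/eqP => z0.
have : (row4 1 0 0 0 *m invmx A *m A) 0 0 = 1 by rewrite mulmxKV // row4E.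
by rewrite mulmx4 z0 z1 z2 a0 !mulr0 !addr0 => /esym/eqP; rewrite oner_eq0.
Qed.

Lemma tau_mxE g1 g2 g3 (v : 'rV[F]_4) :
  v *m tau_mx e eps g1 g2 g3 =
  row4 (v 0 0) (v 0 0 * (g1 * eps) + v 0 1) (v 0 0 * (g2 * eps) + v 0 2)
    (v 0 0 * (g3 + (g1 + g2) ^+ s * eps) + v 0 1 * (g1 + g1 * eps)
     + v 0 2 * (g2 + g2 * eps) + v 0 3).
Proof.
by apply: row4_ext; rewrite mulmx4 row4E !mxE /= !(mulr0, mulr1, addr0, add0r).
Qed.

Lemma linear_cases : exists c g1 g2 g3 : F,
  [/\ c != 0, g1 \in Fq, g2 \in Fq, g3 \in Fq &
     (forall v : 'rV_4, v *m A = c *: (v *m tau_mx e eps g1 g2 g3))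
     \/ (forall v : 'rV_4, v *m A = c *: swap12 (v *m tau_mx e eps g1 g2 g3))].
Proof.
have [a0 a1 a2 a3] := fixes_vertex; have [c0 z1 z2] := fixes_infty.
(* the multiple of A that keeps X0 = 1 *)
pose c := A 0 0; pose B := c^-1 *: A.
have m0 : B 3 3 != 0 by rewrite mxE mulf_neq0 ?invr_neq0.
have B0 : B 0 0 = 1 by rewrite mxE mulVf.
have B13 : B 3 1 = 0 by rewrite mxE a1 mulr0.
have B23 : B 3 2 = 0 by rewrite mxE a2 mulr0.
have [B10 B20 B30] : [/\ B 1 0 = 0, B 2 0 = 0 & B 3 0 = 0].
  by rewrite !mxE z1 z2 a0 !mulr0.
have keepsB x1 x2 x3 : im x3 = Gamma x1 + Gamma x2 ->
  im (B 0 3 + (B 1 3 * x1 + B 2 3 * x2) + B 3 3 * x3)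
    = Gamma (B 0 1 + (B 1 1 * x1 + B 2 1 * x2))
      + Gamma (B 0 2 + (B 1 2 * x1 + B 2 2 * x2)).
  move/eqP; rewrite -inH_affine -keeps -(inHZ _ (invr_neq0 c0)) scalemxAr -/c -/B.
  move=> h; apply/eqP; rewrite -inH_affine; move: h; congr (inH _ = _).
  apply: row4_ext; rewrite mulmx4 !row4E.
  - by rewrite B0 B10 B20 B30 !mulr0 mulr1 !addr0.
  - by rewrite B13; char2.
  - by rewrite B23; char2.
  by char2.
have fin p1 p2 p3 a b : p1 = im p1 * eps -> p2 = im p2 * eps ->
   im p3 = (im p1 + im p2) ^+ s -> a = im p1 + im p1 * eps -> b = im p2 + im p2 * eps ->
   forall v, v *m tau_mx e eps (im p1) (im p2) (re p3)
     = row4 (v 0 0) (v 0 0 * p1 + v 0 1) (v 0 0 * p2 + v 0 2)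
            (v 0 0 * p3 + v 0 1 * a + v 0 2 * b + v 0 3).
  by move=> h1 h2 h3 h4 h5 v; rewrite tau_mxE -h4 -h5 -h3 -h1 -h2 -reim.
have vA v : v *m A = c *: (v *m B) by rewrite -scalemxAr scalerA divff // scale1r.
have [[e12 e21 e1]|[e11 e22 e1]] := rigid_monomial m0 keepsB.
  have [d1 d2 d3 d4 [d5 d6 d7]] := rigid_diag m0 keepsB e12 e21 e1.
  exists c, (im (B 0 1)), (im (B 0 2)), (re (B 0 3)); split=> //; left => v.
  rewrite vA (fin _ _ _ _ _ d3 d4 d7 d5 d6); congr (_ *: _).
  apply: row4_ext; rewrite mulmx4 row4E ?B0 ?B10 ?B20 ?B30 ?B13 ?B23 ?e12 ?e21 -?e1 ?d1 ?d2;
    by rewrite !(mulr0, mulr1, addr0).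
have keepsB' x1 x2 x3 : im x3 = Gamma x1 + Gamma x2 ->
  im (B 0 3 + (B 1 3 * x1 + B 2 3 * x2) + B 3 3 * x3)
    = Gamma (B 0 2 + (B 1 2 * x1 + B 2 2 * x2))
      + Gamma (B 0 1 + (B 1 1 * x1 + B 2 1 * x2)).
  by move/keepsB => ->; rewrite addrC.
have [d1 d2 d3 d4 [d5 d6 d7]] := rigid_diag m0 keepsB' e11 e22 e1.
exists c, (im (B 0 2)), (im (B 0 1)), (re (B 0 3)); split=> //; right => v.
rewrite vA (fin _ _ _ _ _ d3 d4 d7 d5 d6); congr (_ *: _).
apply: row4_ext; rewrite mulmx4 !row4E ?B0 ?B10 ?B20 ?B30 ?B13 ?B23 ?e11 ?e22 -?e1 ?d1 ?d2;
  by rewrite !(mulr0, mulr1, addr0).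
Qed.
End LinearCollineation.

(** * The generators are automorphisms *)

(** For a finite set it is enough that the permutation maps it into itself. *)
Lemma Aut_intro (g : {perm point F}) (t : {perm F}) (A : 'M[F]_4) :
  field_aut t -> A \in unitmx -> induces g (semilin t A) ->
  (forall v, inH v -> inH (semilin t A v)) -> g \in AutBT e eps.
Proof.
move=> ht uA hg hH; rewrite inE; apply/andP; split.
  by rewrite inE; apply/existsP; exists t; rewrite ht; apply/existsP; exists A; rewrite uA.
rewrite inE in_setT; rewrite inE; apply/subsetP => P PH; rewrite inE /= apermE.
case: P PH => P Pp PH; have /existsP[v /andP[v0 /eqP PE]] := Pp.
have vP : v \in pset (Point Pp) by rewrite /= PE mem_line.
have := induces_mem hg vP => gP.
rewrite (BT_mem gP) ?semilin_neq0 //; apply: hH; by rewrite -(BT_mem vP).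
Qed.

Lemma Aut_elim (g : {perm point F}) (A : 'M[F]_4) :
  g \in AutBT e eps -> A \in unitmx -> induces g (fun v => v *m A) ->
  forall v, inH (v *m A) = inH v.
Proof.
move=> /setIP[_ gN] uA hg v; have [->|v0] := eqVneq v 0; first by rewrite mul0mx.
have vP := mem_line v : v \in pset (point_of v0).
have vA0 : v *m A != 0 by apply: contraNneq (v0) => z; rewrite -(mulmxK uA v) z mul0mx.
rewrite -(BT_mem vP v0) -(BT_mem (induces_mem hg vP) vA0).
exact: (astabs_act (point_of v0) gN).
Qed.

(** Semilinearity reduces the check on the cone to X0 = 1 and X0 = 0. *)
Lemma keeps_intro (f : 'rV[F]_4 -> 'rV[F]_4) (t : F -> F) :
  (forall c v, f (c *: v) = t c *: f v) -> (forall c, c != 0 -> t c != 0) ->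
  (forall x1 x2 x3, im x3 = Gamma x1 + Gamma x2 -> inH (f (row4 1 x1 x2 x3))) ->
  (forall x1 x2 x3, x1 ^+ q.+1 = x2 ^+ q.+1 -> inH (f (row4 0 x1 x2 x3))) ->
  forall v, inH v -> inH (f v).
Proof.
move=> fZ t0 h1 h0 v; rewrite (row4_eta v).
move: (v 0 0) (v 0 1) (v 0 2) (v 0 3) => a x1 x2 x3.
have [->|a0] := eqVneq a 0; first by rewrite inH_infty => /eqP/eq_of_add0/h0.
have -> : row4 a x1 x2 x3 = a *: row4 1 (a^-1 * x1) (a^-1 * x2) (a^-1 * x3).
  by rewrite row4Z !mulVKf // mulr1.
by rewrite inHZ // inH_affine fZ inHZ ?t0 // => /eqP/h1.
Qed.

Lemma tau_unit g1 g2 g3 : tau_mx e eps g1 g2 g3 \in unitmx.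
Proof.
apply: mx4_upper_unit.
  by move=> [[|[|[|[|i]]]] ?] [[|[|[|[|j]]]] ?].
by move=> [[|[|[|[|i]]]] ?] //=; rewrite oner_eq0.
Qed.

Lemma linear_Aut (g : {perm point F}) (A : 'M[F]_4) : A \in unitmx ->
  induces g (fun v => v *m A) ->
  (forall x1 x2 x3, im x3 = Gamma x1 + Gamma x2 -> inH (row4 1 x1 x2 x3 *m A)) ->
  (forall x1 x2 x3, x1 ^+ q.+1 = x2 ^+ q.+1 -> inH (row4 0 x1 x2 x3 *m A)) ->
  g \in AutBT e eps.
Proof.
move=> uA hg h1 h0; apply: (Aut_intro (frob_aut pchar2 0) uA).
  by apply: induces_eq hg => v; rewrite (semilin_id A (frob0 pchar2)).
move=> v hv; rewrite (semilin_id A (frob0 pchar2)); move: v hv.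
apply: (@keeps_intro _ id) => // c v; by rewrite -scalemxAl.
Qed.

Lemma tau_Aut g1 g2 g3 : g1 \in Fq -> g2 \in Fq -> g3 \in Fq ->
  tau e eps g1 g2 g3 \in AutBT e eps.
Proof.
move=> h1 h2 h3; apply: (linear_Aut (tau_unit g1 g2 g3) (tauP e eps g1 g2 g3)) => x1 x2 x3.
  move=> hx; rewrite tau_mxE !row4E !mul1r inH_affine.
  have G g x : g \in Fq -> Gamma (g * eps + x) = Gamma x + g * re x + g ^+ s.
    move=> hg; rewrite !GammaE reD imD reMl // imMl // re_eps im_eps mulr0 mulr1 add0r.
    by rewrite expD_sigma; char2.
  rewrite !G // !imD hx (im_Fq h3) imMl ?im_eps; last by fq.
  have E g x : g \in Fq -> im (x * (g + g * eps)) = g * re x.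
    by move=> hg; rewrite imM re_coord // im_coord //; char2.
  by rewrite !E // expD_sigma; apply/eqP; char2.
by move=> hx; rewrite tau_mxE !row4E !mul0r !add0r inH_infty hx addxx.
Qed.

Lemma vartheta_Aut : vartheta F \in AutBT e eps.
Proof.
apply: (linear_Aut (unitmx_perm _ _) (vartheta_lin F)) => x1 x2 x3 hx;
  rewrite -swap12_mx /swap12 !row4E.
  by rewrite inH_affine hx addrC.
by rewrite inH_infty hx addxx.
Qed.

Let kappa := delta ^+ s./2.

Lemma kappa_in : kappa \in Fq. Proof. exact: FqX. Qed.

Lemma sigma_half : (s = s./2 * 2)%N.
Proof. by rewrite muln2 -[LHS]odd_double_half sigmaE oddX. Qed.

Lemma kappa_sqr : kappa ^+ 2 = delta ^+ s.
Proof. by rewrite -exprM -sigma_half. Qed.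

Lemma kappa_sigma : kappa ^+ s = delta.
Proof.
rewrite -exprM; have -> : (s./2 * s = q)%N by have := sigma_sqr; have := sigma_half; nia.
exact/FqP.
Qed.

Lemma phi_mxE (v : 'rV[F]_4) : v *m phi_mx e eps delta =
  row4 (v 0 0) (v 0 0 + v 0 1 * (kappa + kappa * eps))
    (v 0 0 + v 0 2 * (kappa + kappa * eps))
    (v 0 1 * (kappa + kappa * eps) + v 0 2 * (kappa + kappa * eps)
     + v 0 3 * delta ^+ s.+1).
Proof.
have kE : delta ^+ (sigma e)./2 * eps ^+ (2 ^ e) = kappa + kappa * eps.
  by rewrite -/q epsq -/s -/kappa; char2.
by apply: row4_ext; rewrite mulmx4 row4E !mxE /= ?kE !(mulr0, mulr1, addr0, add0r).
Qed.

Lemma phi_unit : phi_mx e eps delta \in unitmx.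
Proof.
have e0 := eps_neq0; have d0 := delta_neq0; apply: mx4_upper_unit.
  by move=> [[|[|[|[|i]]]] ?] [[|[|[|[|j]]]] ?].
by move=> [[|[|[|[|i]]]] ?] //=; rewrite ?oner_eq0 ?mulf_neq0 ?expf_neq0.
Qed.

Lemma frob1 : (fun x : F => x ^+ 2) =1 frob 1.
Proof. by move=> x; rewrite frobE expn1. Qed.

Lemma phi_frob : induces (phi e eps delta) (semilin (frob 1) (phi_mx e eps delta)).
Proof.
by apply: induces_eq (phiP e pchar2 eps_neq0 delta_neq0); apply: semilin_eq frob1.
Qed.

Lemma im_sq x : im (x ^+ 2) = im x ^+ 2.
Proof. by rewrite expr2 imM; char2. Qed.

Lemma re_sq x : re (x ^+ 2) = re x ^+ 2 + delta * im x ^+ 2.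
Proof. by rewrite expr2 reM -!expr2. Qed.

(** The identities kappa ^ 2 = delta ^ sigma and kappa ^ sigma = delta make the
    cross terms cancel.  The last summand equals
    im (x ^ 2 * (kappa + kappa * eps)), which is why the matrix of phi repeats
    its diagonal entries in the last column. *)
Lemma Gamma_phi x : Gamma (1 + x ^+ 2 * (kappa + kappa * eps)) =
  1 + delta ^+ s.+1 * Gamma x ^+ 2
  + kappa * (re x ^+ 2 + delta * im x ^+ 2).
Proof.
have rk : re (kappa + kappa * eps) = kappa by rewrite re_coord ?kappa_in.
have ik : im (kappa + kappa * eps) = kappa by rewrite im_coord ?kappa_in.
rewrite !GammaE !reD !imD reM imM rk ik im_sq re_sq (re_Fq Fq1) (im_Fq Fq1).
have k2 := kappa_sqr; have ks := kappa_sigma; have [xr xi] := (re_in x, im_in x).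
move: (re x) (im x) xr xi => a b ha hb.
have -> : (a ^+ 2 + delta * b ^+ 2) * kappa + delta * (b ^+ 2 * kappa) = a ^+ 2 * kappa.
  by char2.
have -> : (a ^+ 2 + delta * b ^+ 2) * kappa + b ^+ 2 * kappa + b ^+ 2 * kappa
          = (a ^+ 2 + delta * b ^+ 2) * kappa by char2.
have sq2 (u : F) : (u ^+ 2) ^+ s = (u ^+ s) ^+ 2 by rewrite exprAC.
rewrite add0r !expD_sigma !expD2 !expr1n !exprMn ?sq2 ?ks ?k2 [delta ^+ s.+1]exprS.
rewrite ?expD_sigma ?exprMn ?sq2 ?ks.
have k2' : kappa * kappa = delta ^+ s by rewrite -expr2.
by char2_with k2'.
Qed.

Lemma phi_Aut : phi e eps delta \in AutBT e eps.
Proof.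
apply: (Aut_intro (frob_aut pchar2 1) phi_unit phi_frob).
apply: (keeps_intro (t := frob 1)).
- by move=> c v; apply: semilinZ (frob_aut pchar2 1).
- by move=> c c0; rewrite frobE expf_neq0.
- move=> x1 x2 x3 hx; rewrite semilin_row4 phi_mxE !row4E -!frob1 expr1n inH_affine.
  rewrite !Gamma_phi !imD.
  have E x : im (x ^+ 2 * (kappa + kappa * eps)) = kappa * (re x ^+ 2 + delta * im x ^+ 2).
    by rewrite imM re_coord ?kappa_in // im_coord ?kappa_in // im_sq re_sq; char2.
  rewrite !E [x3 ^+ 2 * _]mulrC imMl; last by apply: FqX.
  by rewrite im_sq hx expD2; apply/eqP; char2.
move=> x1 x2 x3 hx; rewrite semilin_row4 phi_mxE !row4E -!frob1 expr0n /= inH_infty !add0r.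
by rewrite !exprMn hx addxx.
Qed.

Notation phi := (phi e eps delta).
Notation vartheta := (vartheta F).
Notation tau := (tau e eps).

Lemma phiX j : exists2 M : 'M[F]_4, M \in unitmx & induces (phi ^+ j)%g (semilin (frob j) M).
Proof.
elim: j => [|j [M uM IH]].
  exists 1%:M; first exact: unitmx1.
  rewrite expg0; apply/forallP => P; rewrite perm1 -{1}[pset P]imset_id; apply/eqP/eq_imset => v.
  by rewrite (semilin_id 1%:M (frob0 pchar2)) mulmx1.
exists (map_mx (frob 1) M *m phi_mx e eps delta).
  by rewrite unitmx_mul phi_unit map_unitmx_aut // (frob_aut pchar2).
rewrite expgSr; apply: induces_eq (induces_comp IH phi_frob) => v /=.
rewrite (semilin_comp _ _ _ _ (frob_aut pchar2 1)); apply: semilin_eq => x.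
by rewrite permM !frobE -exprM -expnD addn1.
Qed.

(** * Normal form and order *)

Lemma linear_Aut_cases (g : {perm point F}) (A : 'M[F]_4) :
  g \in AutBT e eps -> A \in unitmx -> induces g (fun v => v *m A) ->
  exists g1 g2 g3 : F, [/\ g1 \in Fq, g2 \in Fq, g3 \in Fq &
    exists b : bool, g = (tau g1 g2 g3 * vartheta ^+ b)%g].
Proof.
move=> gA uA hg; have [c [g1 [g2 [g3 [c0 h1 h2 h3 h]]]]] := linear_cases uA (Aut_elim gA uA hg).
exists g1, g2, g3; split=> //; case: h => h.
  exists false; rewrite expg0 mulg1; apply: induces_inj (tauP _ _ _ _ _).
  apply: (induces_scale c0); first by move=> a v; rewrite -scalemxAl.
  exact: induces_eq h hg.
exists true; rewrite expg1; apply: induces_inj (induces_comp (tauP _ _ _ _ _) (varthetaP F)).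
apply: (induces_scale c0); last exact: induces_eq h hg.
by move=> a v /=; rewrite !swap12_mx -!scalemxAl.
Qed.

(** The normal form of the elements of the group.  The exponent of phi is
    negative because phi ^ j is multiplied on the right to make g linear. *)
Definition decode (x : F * F * F * (bool * 'I_N)) : {perm point F} :=
  let: (g1, g2, g3, (b, j)) := x in (tau g1 g2 g3 * vartheta ^+ b * (phi ^+ j)^-1)%g.

Definition codes : {set F * F * F * (bool * 'I_N)} :=
  setX (setX (setX Fq Fq) Fq) setT.

Lemma codesP g1 g2 g3 b j :
  reflect [/\ g1 \in Fq, g2 \in Fq & g3 \in Fq] ((g1, g2, g3, (b, j)) \in codes).
Proof.
rewrite !in_setX in_setT andbT -andbA; exact: and3P.
Qed.

Lemma card_codes : #|codes| = (4 * e * (2 ^ e) ^ 3)%N.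
Proof.
rewrite !cardsX cardsT card_prod card_bool card_ord card_Fq /N -/q -muln2; lia.
Qed.

(** If g involves the i-th power of the Frobenius map, then g phi ^ (2 e - i) is
    linear, and it is covered by the classification of the linear case. *)
Lemma decode_onto (g : {perm point F}) : g \in AutBT e eps ->
  exists2 x, x \in codes & g = decode x.
Proof.
move=> gA; have /setIP[] := gA; rewrite inE.
move=> /existsP[t /andP[ta /existsP[A /andP[uA hg]]]] _.
have [i iN tE] := field_aut_frob pchar2 cardF2 ta.
have [j jN ijE] : exists2 j, (j < N)%N & forall x : F, (x ^+ (2 ^ i)) ^+ (2 ^ j) = x.
  case: (posnP i) iN => [-> _|i0 iN].
    by exists 0; rewrite ?(N_gt0 cardF2) // => x; rewrite expn0 !expr1.
  exists (N - i)%N => [|x]; first by lia.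
  by rewrite -exprM -expnD subnKC ?(ltnW iN) // -cardF2 expf_card.
have [M uM hM] := phiX j.
have gpA : (g * phi ^+ j)%g \in AutBT e eps by rewrite groupM // groupX // phi_Aut.
have := linear_Aut_cases gpA (A := map_mx (frob j) A *m M).
case=> [||g1 [g2 [g3 [h1 h2 h3 [b hb]]]]].
- by rewrite unitmx_mul uM map_unitmx_aut // (frob_aut pchar2).
- apply: induces_eq (induces_comp hg hM) => v /=.
  rewrite (semilin_comp _ _ _ _ (frob_aut pchar2 j)) semilin_id // => x.
  by rewrite permM frobE tE ijE.
exists (g1, g2, g3, (b, Ordinal jN)); first exact/codesP.
by rewrite /decode /= -hb mulgK.
Qed.

Lemma tau_vartheta_lin g1 g2 g3 (b : bool) : exists2 A : 'M[F]_4, A \in unitmx &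
  induces (tau g1 g2 g3 * vartheta ^+ b)%g (fun v => v *m A).
Proof.
case: b.
  exists (tau_mx e eps g1 g2 g3 *m perm_mx (tperm 1 2)).
    by rewrite unitmx_mul tau_unit unitmx_perm.
  apply: induces_eq (induces_comp (tauP _ _ _ _ _) (vartheta_lin F)) => v /=.
  by rewrite mulmxA.
exists (tau_mx e eps g1 g2 g3); first exact: tau_unit.
by rewrite expg0 mulg1; apply: tauP.
Qed.

Lemma tau_vartheta_map g1 g2 g3 (b : bool) :
  induces (tau g1 g2 g3 * vartheta ^+ b)%g
    (fun v => let w := v *m tau_mx e eps g1 g2 g3 in if b then swap12 w else w).
Proof.
case: b => /=; last by rewrite expg0 mulg1; apply: tauP.
by rewrite expg1; apply: induces_comp (tauP _ _ _ _ _) (varthetaP F).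
Qed.

Lemma tau_vartheta_inj g1 g2 g3 (b : bool) g1' g2' g3' (b' : bool) :
  (tau g1 g2 g3 * vartheta ^+ b = tau g1' g2' g3' * vartheta ^+ b')%g ->
  [/\ g1 = g1', g2 = g2', g3 = g3' & b = b'].
Proof.
move=> E.
have m1 := tau_vartheta_map g1 g2 g3 b; rewrite E in m1.
have m2 := tau_vartheta_map g1' g2' g3' b'.
have lin a (v : 'rV[F]_4) : (let w := (a *: v) *m tau_mx e eps g1' g2' g3' in if b' then swap12 w else w)
    = a *: (let w := v *m tau_mx e eps g1' g2' g3' in if b' then swap12 w else w).
  by case: (b'); rewrite /= ?swap12_mx -!scalemxAl.
have bb : b = b'.
  have [a /rowP h] := induces_prop (row4_01_neq0 0 0) m1 m2 (lin ^~ _).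
  have := h 1; have := h 2; move: h; case: (b); case: (b') => //= _;
    rewrite !tau_mxE /swap12 !mxE /= !(mul0r, mulr0, add0r, addr0).
    by move/eqP; rewrite oner_eq0.
  by move=> _ /eqP; rewrite oner_eq0.
rewrite -bb in E; move/mulIg: E => E.
have m := tauP e eps g1 g2 g3; rewrite E in m.
have linT a (v : 'rV[F]_4) : (a *: v) *m tau_mx e eps g1' g2' g3' = a *: (v *m tau_mx e eps g1' g2' g3').
  by rewrite -scalemxAl.
have [a] := induces_prop (row4_1_neq0 0 0 0) m (tauP e eps g1' g2' g3') (linT ^~ _).
rewrite !tau_mxE !row4E !(mul0r, mul1r, addr0) row4Z => /rowP h.
have := h 0; rewrite !row4E mulr1 => a1; move: h; rewrite -a1 !mul1r => h.
have G1 : g1 = g1' by apply: (mulIf eps_neq0); have := h 1; rewrite !row4E.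
have G2 : g2 = g2' by apply: (mulIf eps_neq0); have := h 2; rewrite !row4E.
split=> //; have := h 3; rewrite !row4E G1 G2; exact: addIr.
Qed.

(** For j <= j', equality of two codes makes phi ^ (j' - j) a quotient of two
    linear collineations, hence linear, and j' - j < 2 e forces j = j'. *)
Lemma decode_inj : injective decode.
Proof.
have half : forall g1 g2 g3 b (j : 'I_N) g1' g2' g3' b' (j' : 'I_N),
    (j <= j')%N -> decode (g1, g2, g3, (b, j)) = decode (g1', g2', g3', (b', j')) ->
    (g1, g2, g3, (b, j)) = (g1', g2', g3', (b', j')).
  move=> g1 g2 g3 b j g1' g2' g3' b' j' jj.
  rewrite /decode /= => E.
  have E' : (tau g1 g2 g3 * vartheta ^+ b * phi ^+ (j' - j) = tau g1' g2' g3' * vartheta ^+ b')%g.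
    have -> : (phi ^+ (j' - j) = (phi ^+ j)^-1 * phi ^+ j')%g.
      by rewrite -{2}(subnKC jj) expgD mulKg.
    by rewrite mulgA E mulgKV.
  have [A uA hA] := tau_vartheta_lin g1 g2 g3 b.
  have [A' uA' hA'] := tau_vartheta_lin g1' g2' g3' b'.
  have [M uM hM] := phiX (j' - j).
  pose d := (j' - j)%N.
  have hl : induces (tau g1' g2' g3' * vartheta ^+ b')%g
      (semilin (frob d) (map_mx (frob d) A *m M)).
    rewrite -E'; apply: induces_eq (induces_comp hA hM) => v /=.
    have [dD dM] := field_autP (frob_aut pchar2 d).
    rewrite -{1}(semilin_id A (frob0 pchar2)) (semilin_comp _ _ _ _ (frob_aut pchar2 d)).
    by apply: semilin_eq => x; rewrite permM (frob0 pchar2).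
  have uAM : map_mx (frob d) A *m M \in unitmx by rewrite unitmx_mul uM map_unitmx_aut // (frob_aut pchar2).
  have fid := linear_semilin_id uA' uAM (frob_aut pchar2 d) hA' hl.
  have d0 : d = 0.
    apply: (frob_fixes cardF2); first exact: leq_ltn_trans (leq_subr _ _) (ltn_ord j').
    by move=> x; have := fid x; rewrite frobE.
  have <- : j = j' by apply: val_inj; apply/eqP; rewrite eqn_leq jj -subn_eq0 -/d d0.
  rewrite -/d d0 expg0 mulg1 in E'.
  by have [-> -> -> ->] := tau_vartheta_inj E'.
move=> [[[g1 g2] g3] [b j]] [[[g1' g2'] g3'] [b' j']] E.
case/orP: (leq_total j j') => jj; first exact: half.
by apply/esym/half.
Qed.

Lemma tau_in_E g1 g2 g3 : g1 \in Fq -> g2 \in Fq -> g3 \in Fq ->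
  tau g1 g2 g3 \in Egroup e eps.
Proof.
move=> h1 h2 h3; apply: mem_gen; rewrite inE.
apply/existsP; exists g1; rewrite h1; apply/existsP; exists g2; rewrite h2.
by apply/existsP; exists g3; rewrite h3 eqxx.
Qed.

Lemma Aut_structure :
  AutBT e eps = (Egroup e eps * <<[set vartheta; phi]>>)%g
  /\ #|AutBT e eps| = (4 * e * (2 ^ e) ^ 3)%N.
Proof.
split.
  apply/eqP; rewrite eqEsubset; apply/andP; split; last first.
    apply: mul_subG; rewrite gen_subG; apply/subsetP => g; last first.
      by rewrite in_set2 => /orP[] /eqP->; [apply: vartheta_Aut | apply: phi_Aut].
    rewrite inE => /existsP[g1 /andP[h1 /existsP[g2 /andP[h2 /existsP[g3 /andP[h3 /eqP->]]]]]].
    exact: tau_Aut.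
  apply/subsetP => g /decode_onto[[[[g1 g2] g3] [b j]] /codesP[h1 h2 h3] ->].
  rewrite /decode -mulgA; apply: mem_mulg; first exact: tau_in_E.
  by rewrite groupM ?groupV ?groupX // mem_gen // !inE eqxx ?orbT.
rewrite -card_codes -(card_imset _ decode_inj); apply: eq_card => g.
apply/idP/imsetP => [/decode_onto //|[[[[g1 g2] g3] [b j]] /codesP[h1 h2 h3] ->]].
rewrite /decode; apply: groupM; last by rewrite groupV groupX // phi_Aut.
by rewrite groupM ?tau_Aut // groupX // vartheta_Aut.
Qed.

End BTVariety.

Theorem theorem4p7 (F : finFieldType) (e : nat) (eps delta : F)
    (e_ge3 : (3 <= e)%N) (e_odd : odd e)
    (cardF : #|F| = ((2 ^ e) ^ 2)%N)
    (eps_notin : eps \notin Fq F e)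
    (delta_in : delta \in Fq F e)
    (delta_neq1 : delta != 1)
    (delta_tr : abs_trace e delta = 1)
    (eps_root : eps ^+ 2 + eps + delta = 0) :
  AutBT e eps
    = (Egroup e eps * <<[set vartheta F; phi e eps delta]>>)%g
  /\ #|AutBT e eps| = (4 * e * (2 ^ e) ^ 3)%N.
Proof. exact: Aut_structure. Qed.
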